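(* Let $H$ be a smooth $\Lambda$-periodic function on $\mathbb R^n$ with $\min H=0$, and let $F_\Lambda\subset\mathbb R^n$ be the closed set where $H$ attains its minimum. Assume that $F_\Lambda$ is discrete. Then, for any initial data $\psi_0\in\mathcal C_\Lambda$, the unique viscosity solution $\psi_t$ in $\mathcal C_\Lambda$ of the Hamilton-Jacobi equation $$\frac{\partial\psi_t(y)}{\partial t}+H(\nabla\psi_t(y))=0,\qquad\psi_{|t=0}=\psi_0,$$ converges uniformly, as $t\to\infty$, to the convex piecewise affine function $$\psi_\infty(y):=\sup_{x\in F_\Lambda}\ x\cdot y-\psi_0^*(x).$$ Equivalently, with $\phi_0=\psi_0^*$, the large $\beta$-limit $\phi_t$ of the solutions $\phi^{(\beta)}_t\in\mathcal C_\Lambda$ of $$\frac{\partial\phi_t^{(\beta)}(x)}{\partial t}=\frac1\beta\log\det(\partial^2\phi_t^{(\beta)}(x))+H(x),\qquad \phi^{(\beta)}_{|t=0}=\phi_0,$$ converges, as $t\to\infty$, to the convex piecewise affine function $\phi_\infty$ whose graph is the convex hull of the discrete graph of the function $\phi_0$ restricted to $F_\Lambda$.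
   Context: $\Lambda$ is a lattice in $\mathbb R^n$ whose fundamental domain has unit volume; ''$\Lambda$-periodic'' means invariant under translations by $\Lambda$. $\mathcal C_\Lambda$ is the space of all convex functions $u$ on $\mathbb R^n$ such that $u(y)-|y|^2/2$ is $\Lambda$-periodic. Legendre transform: $g^*(y):=\sup_{x\in\mathbb R^n}x\cdot y-g(x)$. In the formulation with $\phi_t^{(\beta)}$ (the twisted Kähler-Ricci flow in the torus-invariant setting), the initial function $\phi_0$ is smooth and strictly convex, $\phi^{(\beta)}_t$ denotes the smooth strictly convex solution in $\mathcal C_\Lambda$, and $\phi_t=\lim_{\beta\to\infty}\phi_t^{(\beta)}$. ''The graph of $\phi_\infty$ is the convex hull of the graph of $\phi_0|_{F_\Lambda}$'' is understood in the sense of lower convex hull: $\phi_\infty$ is the largest convex function $\phi$ on $\mathbb R^n$ with $\phi\le\phi_0$ on $F_\Lambda$. Viscosity solution is in the sense of Crandall-Lions. *)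

(* Defs.v *)
From mathcomp Require Export all_boot all_order all_algebra.
From mathcomp Require Export all_classical all_reals all_analysis.

Set Implicit Arguments.
Unset Strict Implicit.
Unset Printing Implicit Defensive.

Export Order.TTheory GRing.Theory Num.Theory.
Export numFieldNormedType.Exports.

Local Open Scope classical_set_scope.
Local Open Scope ring_scope.

(* The norm of the library on ['rV[R]_n] is the sup norm; the Euclidean
   structure of R^n is given by [dot]. *)
Definition dot (R : realType) (n : nat) (x y : 'rV[R]_n) : R :=
  \sum_(i < n) x 0 i * y 0 i.

(* Lattices of R^n: the integer combinations of the rows of an invertible
   matrix [B]; the parallelepiped spanned by these rows is a fundamental
   domain, and its volume is [`|\det B|]. *)
Definition unimodular_lattice (R : realType) (n : nat) (L : set 'rV[R]_n) :=
  exists2 B : 'M[R]_n, `|\det B| = 1 &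
    L = [set x | exists z : 'rV[int]_n, x = map_mx intr z *m B].

Definition periodic (R : realType) (n : nat) (L : set 'rV[R]_n)
    (g : 'rV[R]_n -> R) :=
  forall x l, L l -> g (x + l) = g x.

Definition convex_fun (R : realType) (n : nat) (f : 'rV[R]_n -> R) :=
  @convex_function R 'rV[R]_n [set: 'rV[R]_n] f.

Definition strictly_convex (R : realType) (n : nat) (f : 'rV[R]_n -> R) :=
  forall (x y : 'rV[R]_n) (t : R), x != y -> 0 < t < 1 ->
    f (t *: x + (1 - t) *: y) < t * f x + (1 - t) * f y.

Definition CL (R : realType) (n : nat) (L : set 'rV[R]_n) :
    set ('rV[R]_n -> R) :=
  [set u | convex_fun u /\ periodic L (fun y => u y - dot y y / 2)].

(* [sup] is only meaningful here because its argument is bounded above, which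
   holds whenever [g] is in [CL L] for a lattice [L]. *)
Definition legendre (R : realType) (n : nat) (g : 'rV[R]_n -> R) :
    'rV[R]_n -> R :=
  fun y => sup [set dot x y - g x | x in [set: 'rV[R]_n]].

Definition minset (R : realType) (n : nat) (H : 'rV[R]_n -> R) :
    set 'rV[R]_n :=
  [set x | forall y, H x <= H y].

Definition discrete_set (T : topologicalType) (A : set T) :=
  A `<=` isolated A.

Fixpoint iter_derive (R : realType) (V : normedModType R) (vs : seq V)
    (f : V -> R) : V -> R :=
  if vs is v :: vs' then 'D_v (iter_derive vs' f) else f.

(* On an open set [U], this is C^infinity: differentiability of all iterated
   directional derivatives includes their existence and continuity. *)
Definition smooth_on (R : realType) (V : normedModType R) (U : set V)
    (f : V -> R) :=
  forall (vs : seq V) (x : V), U x -> differentiable (iter_derive vs f) x.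

Definition C1_on (R : realType) (V : normedModType R) (U : set V)
    (f : V -> R) :=
  forall x : V, U x ->
    differentiable f x /\ forall v : V, {for x, continuous ('D_v f)}.

Definition grad (R : realType) (n : nat) (f : 'rV[R]_n -> R) (x : 'rV[R]_n) :
    'rV[R]_n :=
  \row_i 'D_(delta_mx 0 i) f x.

Definition hessian (R : realType) (n : nat) (f : 'rV[R]_n -> R)
    (x : 'rV[R]_n) : 'M[R]_n :=
  \matrix_(i, j) 'D_(delta_mx 0 i) ('D_(delta_mx 0 j) f) x.

(* Time-dependent functions on R^n have type [R -> 'rV[R]_n -> R]; only their
   values at nonnegative times are relevant. *)
Definition spacetime (R : realType) (n : nat) (u : R -> 'rV[R]_n -> R) :
    R * 'rV[R]_n -> R :=
  fun p => u p.1 p.2.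

Definition pos_times (R : realType) (n : nat) : set (R * 'rV[R]_n) :=
  [set p | 0 < p.1].

Definition nonneg_times (R : realType) (n : nat) : set (R * 'rV[R]_n) :=
  [set p | 0 <= p.1].

Definition hamilton_jacobi (R : realType) (n : nat) (H : 'rV[R]_n -> R)
    (f : R * 'rV[R]_n -> R) (t : R) (y : 'rV[R]_n) : R :=
  derive1 (fun s : R => f (s, y)) t + H (grad (fun z => f (t, z)) y).

Definition viscosity_subsolution (R : realType) (n : nat) (H : 'rV[R]_n -> R)
    (u : R -> 'rV[R]_n -> R) :=
  forall (f : R * 'rV[R]_n -> R) (t : R) (y : 'rV[R]_n),
    C1_on (@pos_times R n) f -> 0 < t ->
    (\forall p \near (t, y),
      spacetime u p - f p <= spacetime u (t, y) - f (t, y)) ->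
    hamilton_jacobi H f t y <= 0.

Definition viscosity_supersolution (R : realType) (n : nat) (H : 'rV[R]_n -> R)
    (u : R -> 'rV[R]_n -> R) :=
  forall (f : R * 'rV[R]_n -> R) (t : R) (y : 'rV[R]_n),
    C1_on (@pos_times R n) f -> 0 < t ->
    (\forall p \near (t, y),
      spacetime u p - f p >= spacetime u (t, y) - f (t, y)) ->
    hamilton_jacobi H f t y >= 0.

Definition viscosity_solution (R : realType) (n : nat) (H : 'rV[R]_n -> R)
    (L : set 'rV[R]_n) (psi0 : 'rV[R]_n -> R)
    (psi : R -> 'rV[R]_n -> R) :=
  [/\ forall t, 0 <= t -> CL L (psi t),
      {within @nonneg_times R n, continuous (spacetime psi)},
      psi 0 = psi0,
      viscosity_subsolution H psi &
      viscosity_supersolution H psi].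

(* Since [ln] is total, positivity of the determinant is part of the equation.
   The solution is only required to be smooth at positive times and continuous
   up to the initial time. *)
Definition monge_ampere_flow (R : realType) (n : nat) (H : 'rV[R]_n -> R)
    (L : set 'rV[R]_n) (beta : R)
    (phi0 : 'rV[R]_n -> R) (phi : R -> 'rV[R]_n -> R) :=
  [/\ forall t, 0 <= t -> CL L (phi t),
      {within @nonneg_times R n, continuous (spacetime phi)},
      phi 0 = phi0,
      smooth_on (@pos_times R n) (spacetime phi) &
      forall t, 0 < t -> strictly_convex (phi t) /\ forall x,
        0 < \det (hessian (phi t) x) /\
        derive1 (fun s : R => phi s x) t =
          beta^-1 * ln (\det (hessian (phi t) x)) + H x].

Definition polyhedron (R : realType) (n : nat) (P : set 'rV[R]_n) :=
  exists s : seq ('rV[R]_n * R),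
    P = [set x | forall c, c \in s -> dot c.1 x <= c.2].

Definition affine_on (R : realType) (n : nat) (P : set 'rV[R]_n)
    (f : 'rV[R]_n -> R) :=
  exists (a : 'rV[R]_n) (b : R), forall x, P x -> f x = dot a x + b.

(* Near every point, finitely many polyhedra on each of which [f] is affine
   cover the space. *)
Definition piecewise_affine (R : realType) (n : nat) (f : 'rV[R]_n -> R) :=
  forall x : 'rV[R]_n, exists k (P : 'I_k -> set 'rV[R]_n),
    (forall i, polyhedron (P i) /\ affine_on (P i) f) /\
    \forall y \near x, exists i, P i y.

(* [f] is the function whose graph is the (lower) convex hull of the graph of
   the restriction of [g] to [A]. *)
Definition lower_convex_hull (R : realType) (n : nat) (A : set 'rV[R]_n)
    (g f : 'rV[R]_n -> R) :=
  [/\ convex_fun f,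
      forall x, A x -> f x <= g x &
      forall h : 'rV[R]_n -> R, convex_fun h ->
        (forall x, A x -> h x <= g x) -> forall x, h x <= f x].

(* Main.v *)
(* The solution is given by the Hopf formula psi_t = (phi0 + t H)^*, a supremum of
   affine functions of (t, y), each of which is a classical solution. It is a
   subsolution because a maximizing affine function touches it from below, and a
   supersolution because it is jointly convex. Any solution lies above these
   affine functions by comparison, and below psi_t by doubling of variables. As
   t grows, the term t H forces the maximizer towards the zeros of H, whence the
   limit. Near each point only finitely many zeros matter, so psi_infty is
   locally a finite maximum of affine functions; so is its Legendre transform,
   since the supremum defining it is attained at one of the locally finitely
   many points determined by their set of active affine pieces.
   For the parabolic flow, at a maximum of phi - phi0 - t H the Hessian of phi is
   bounded above, and at a maximum of <x, z> + delta |x - z|^2 / 2 - phi - psi it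
   is bounded below by delta; in both cases the determinant term is O(1/beta), so
   that phi converges to the convex envelope psi_t^* of phi0 + t H. *)
From HB Require Import structures.
From mathcomp Require Import ring lra.
Require Import Defs.

Set Implicit Arguments.
Unset Strict Implicit.
Unset Printing Implicit Defensive.

Local Open Scope classical_set_scope.
Local Open Scope ring_scope.

(** Space is not compact. A function of [CL] differs from |y|^2/2 by a periodic, hence bounded,
    function; a lattice translation or the quadratic growth therefore brings every competitor for a
    maximum into a fixed compact set. In time, a maximum over [[0, T]] reached at [T] need not be a
    local one. The penalty [eta * t + C * t ^+ N.+1] keeps it away from there; being a polynomial
    with nonnegative coefficients, it enters test functions on all of space-time, and its slope, at
    least [eta], has the sign that contradicts the equation.

    The Hopf solution need not be differentiable, and in the doubled problems the function touching
    it from below is at hand only along rays. The supersolution property is therefore proved in a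
    stronger form, from one-sided slopes on segments that lead back to time 0. This form serves both
    doubling arguments, including the one for the flow, where the touching function contains [phi]
    itself. *)

Section ContinuousFunctions.
Variables (R : realType) (T : topologicalType).
Implicit Types f g : T -> R.

Lemma continuous_addf f g : continuous f -> continuous g -> continuous (fun x => f x + g x).
Proof. by move=> cf cg x; apply: cvgD; [exact: cf|exact: cg]. Qed.

Lemma continuous_subf f g : continuous f -> continuous g -> continuous (fun x => f x - g x).
Proof. by move=> cf cg x; apply: cvgB; [exact: cf|exact: cg]. Qed.

Lemma continuous_mulf f g : continuous f -> continuous g -> continuous (fun x => f x * g x).
Proof. by move=> cf cg x; apply: cvgM; [exact: cf|exact: cg]. Qed.

End ContinuousFunctions.

Section ContinuousProjections.
Variables (T U V : topologicalType).

Lemma continuous_compf (f : U -> V) (g : T -> U) :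
  continuous f -> continuous g -> continuous (fun x => f (g x)).
Proof. by move=> cf cg x; apply: continuous_comp; [exact: cg|exact: cf]. Qed.

Lemma continuous_pair (f : T -> U) (g : T -> V) :
  continuous f -> continuous g -> continuous (fun x => (f x, g x)).
Proof. by move=> cf cg x; apply: cvg_pair; [exact: cf|exact: cg]. Qed.

Lemma continuous_fst : continuous (@fst T U).
Proof. by move=> p; exact: cvg_fst. Qed.

Lemma continuous_snd : continuous (@snd T U).
Proof. by move=> p; exact: cvg_snd. Qed.

End ContinuousProjections.

(** * Inner product, half square and sup norm *)

Section Euclidean.
Variables (R : realType) (n : nat).
Implicit Types (x y z : 'rV[R]_n) (a : R).

Definition halfsq x : R := dot x x / 2.

Lemma dotC x y : dot x y = dot y x.
Proof. by apply: eq_bigr => i _; rewrite mulrC. Qed.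

Lemma dotDl x y z : dot (x + y) z = dot x z + dot y z.
Proof. by rewrite -big_split; apply: eq_bigr => i _; rewrite mxE mulrDl. Qed.

Lemma dotDr x y z : dot z (x + y) = dot z x + dot z y.
Proof. by rewrite dotC dotDl !(dotC z). Qed.

Lemma dotZl a x y : dot (a *: x) y = a * dot x y.
Proof. by rewrite mulr_sumr; apply: eq_bigr => i _; rewrite mxE mulrA. Qed.

Lemma dotZr a x y : dot x (a *: y) = a * dot x y.
Proof. by rewrite dotC dotZl dotC. Qed.

Lemma dotNl x y : dot (- x) y = - dot x y.
Proof. by rewrite -scaleN1r dotZl mulN1r. Qed.

Lemma dotNr x y : dot x (- y) = - dot x y.
Proof. by rewrite dotC dotNl dotC. Qed.

Lemma dot0l x : dot 0 x = 0.
Proof. by rewrite -(scale0r 0) dotZl mul0r. Qed.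

Lemma dot0r x : dot x 0 = 0.
Proof. by rewrite dotC dot0l. Qed.

Definition dotE := (dotDl, dotDr, dotNl, dotNr, dotZl, dotZr, dot0l, dot0r).

Lemma dot_delta x i : dot x (delta_mx 0 i) = x 0 i.
Proof.
rewrite /dot (bigD1 i)//= big1 ?addr0 ?mxE ?eqxx ?mulr1// => j ji.
by rewrite mxE (negbTE ji) andbF mulr0.
Qed.

Lemma dot_ge0 x : 0 <= dot x x.
Proof. by apply: sumr_ge0 => i _; rewrite -expr2 sqr_ge0. Qed.

Lemma coord_sq_le_dot x i : x 0 i ^+ 2 <= dot x x.
Proof.
rewrite /dot (bigD1 i)//= -expr2 lerDl.
by apply: sumr_ge0 => j _; rewrite -expr2 sqr_ge0.
Qed.

Lemma coord_le_norm x i : `|x 0 i| <= `|x|.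
Proof.
rewrite [leRHS]/Num.norm /= mx_normrE; apply/bigmax_geP; right => /=.
by exists (0, i).
Qed.

Lemma norm_le_coord x a : 0 <= a -> (forall i, `|x 0 i| <= a) -> `|x| <= a.
Proof.
move=> a0 xa; rewrite [leLHS]/Num.norm /= mx_normrE; apply/bigmax_leP; split => //.
by move=> [i j] _ /=; rewrite ord1.
Qed.

Lemma norm_dot_le x y : `|dot x y| <= n%:R * (`|x| * `|y|).
Proof.
apply: le_trans (ler_norm_sum _ _ _) _.
rewrite mulr_natl -[X in _ *+ X]card_ord -sumr_const ler_sum// => i _.
by rewrite normrM ler_pM// coord_le_norm.
Qed.

Lemma sqr_norm_le_dot x : `|x| ^+ 2 <= dot x x.
Proof.
rewrite -[leRHS]sqr_sqrtr ?dot_ge0// ler_pXn2r// ?nnegrE ?sqrtr_ge0//.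
apply: norm_le_coord; rewrite ?sqrtr_ge0// => i.
by rewrite -sqrtr_sqr ler_wsqrtr// coord_sq_le_dot.
Qed.

Lemma halfsq_ge0 x : 0 <= halfsq x.
Proof. by rewrite divr_ge0// dot_ge0. Qed.

Lemma halfsq0 : halfsq 0 = 0.
Proof. by rewrite /halfsq dot0l mul0r. Qed.

Lemma halfsqD x y : halfsq (x + y) = halfsq x + dot x y + halfsq y.
Proof. by rewrite /halfsq !dotE (dotC y x); field. Qed.

Lemma halfsqB x y : halfsq (x - y) = halfsq x - dot x y + halfsq y.
Proof. by rewrite /halfsq !dotE (dotC y x); field. Qed.

Lemma halfsqZ a x : halfsq (a *: x) = a ^+ 2 * halfsq x.
Proof. by rewrite /halfsq !dotE; field. Qed.

Lemma halfsqN x : halfsq (- x) = halfsq x.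
Proof. by rewrite /halfsq !dotE; field. Qed.

Lemma norm_le_of_halfsq x a : 0 < a -> halfsq x <= a ^+ 2 / 2 -> `|x| <= a.
Proof.
move=> a0 xa; rewrite -(@ler_pXn2r _ 2)// ?nnegrE//; last exact: ltW.
by have := sqr_norm_le_dot x; rewrite /halfsq in xa => h; lra.
Qed.

Lemma cvg_dot (T : Type) (F : set_system T) (FF : Filter F)
    (f g : T -> 'rV[R]_n) x y : f @ F --> x -> g @ F --> y ->
  dot (f t) (g t) @[t --> F] --> dot x y.
Proof.
move=> fx gy; apply: cvg_big; first exact: add_continuous.
move=> i _; apply: cvgM.
- by apply: (cvg_comp f (fun v : 'rV[R]_n => v 0 i) fx); exact: coord_continuous.
- by apply: (cvg_comp g (fun v : 'rV[R]_n => v 0 i) gy); exact: coord_continuous.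
Qed.

Lemma continuous_dot (T : topologicalType) (f g : T -> 'rV[R]_n) :
  continuous f -> continuous g -> continuous (fun t => dot (f t) (g t)).
Proof. by move=> cf cg t; apply: cvg_dot; [exact: cf|exact: cg]. Qed.

Lemma continuous_halfsq (T : topologicalType) (f : T -> 'rV[R]_n) :
  continuous f -> continuous (fun t => halfsq (f t)).
Proof.
move=> cf; apply: continuous_mulf; first exact: continuous_dot.
exact: cst_continuous.
Qed.

End Euclidean.

(** * Subgradients and Legendre transforms *)

Section Convexity.
Variables (R : realType) (n : nat).
Implicit Types (f g : 'rV[R]_n -> R) (x y z p : 'rV[R]_n).

Lemma convex_funP f : convex_fun f <->
  forall x y (t : R), 0 <= t <= 1 ->
    f (t *: x + (1 - t) *: y) <= t * f x + (1 - t) * f y.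
Proof.
split=> [cf x y t /andP[t0 t1]|cf t x y _ _].
  by have := cf (Itv01 t0 t1) x y; rewrite !inE => /(_ I I).
by apply: (cf x y t%:num); rewrite ge0 le1.
Qed.

(* One step of the Hahn-Banach extension, from [V] to [V] plus a line. *)
Lemma subgradient_step f x p (k : 'I_n) (V : set 'rV[R]_n) : convex_fun f ->
  (forall z z' (a b : R), V z -> V z' -> V (a *: z + b *: z')) -> V 0 ->
  (forall z, V z -> f x + dot p z <= f (x + z)) ->
  exists c : R, forall z (s : R), V z ->
    f x + dot p z + c * s <= f (x + z + s *: delta_mx 0 k).
Proof.
move=> /convex_funP cf VD V0 Vp; set e := delta_mx _ _.
(* [lo] collects the backward difference quotients in direction [e], and [ub] bounds them by the
   forward ones. Every slope between the two families is admissible; the supremum of [lo] is one. *)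
pose lo := [set c : R | exists z (r : R),
  [/\ V z, 0 < r & c = (f x + dot p z - f (x + z - r *: e)) / r]].
have ub z (s : R) : V z -> 0 < s ->
    ubound lo ((f (x + z + s *: e) - f x - dot p z) / s).
  move=> Vz s0 _ [z' [r [Vz' r0 ->]]].
  rewrite /= ler_pdivrMr// mulrAC ler_pdivlMr//.
  have rs0 : 0 < r + s by rewrite addr_gt0.
  have t01 : 0 <= s / (r + s) <= 1.
    by rewrite ler_pdivrMr// mul1r lerDr (ltW r0) divr_ge0// ltW.
  have := cf (x + z' - r *: e) (x + z + s *: e) _ t01.
  have -> : 1 - s / (r + s) = r / (r + s) by field; rewrite gt_eqF.
  have -> : (s / (r + s)) *: (x + z' - r *: e) + (r / (r + s)) *: (x + z + s *: e)
      = x + ((s / (r + s)) *: z' + (r / (r + s)) *: z).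
    apply/rowP => i; rewrite !mxE; field; rewrite gt_eqF//.
  have := Vp _ (VD _ _ (s / (r + s)) (r / (r + s)) Vz' Vz).
  rewrite !dotE => h1 h2; have := le_trans h1 h2.
  rewrite -(ler_pM2r rs0).
  rewrite [X in X <= _ -> _](_ : _ = f x * (r + s) + s * dot p z' + r * dot p z);
    last by field; rewrite gt_eqF.
  rewrite [X in _ <= X -> _](_ : _ = s * f (x + z' - r *: e) + r * f (x + z + s *: e));
    last by field; rewrite gt_eqF.
  by move=> *; lra.
have lo0 : has_sup lo.
  split; last by exists ((f (x + 0 + 1 *: e) - f x - dot p 0) / 1); exact: ub.
  by exists ((f x + dot p 0 - f (x + 0 - 1 *: e)) / 1); exists 0, 1.
exists (sup lo) => z s Vz; have [s0|s0|<-] := ltgtP 0 s.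
- have : sup lo <= (f (x + z + s *: e) - f x - dot p z) / s.
    by apply: ge_sup; [case: lo0 | exact: ub].
  by rewrite ler_pdivlMr// => ?; lra.
- have : (f x + dot p z - f (x + z - (- s) *: e)) / (- s) <= sup lo.
    apply: ub_le_sup; first by case: lo0.
    by exists z, (- s); split => //; rewrite oppr_gt0.
  rewrite ler_pdivrMr ?oppr_gt0// scaleNr opprK => ?; lra.
- by rewrite mulr0 scale0r !addr0; exact: Vp.
Qed.

(** Induction on the number [k] of leading coordinates in which the increment may be nonzero, each
    step extending the supporting functional by one coordinate direction. *)
Lemma subgradient_exists f x : convex_fun f ->
  exists p, forall y, f x + dot p (y - x) <= f y.
Proof.
move=> cf.
have H k : (k <= n)%N -> exists p, forall z : 'rV[R]_n,
    (forall i : 'I_n, (k <= i)%N -> z 0 i = 0) -> f x + dot p z <= f (x + z).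
  elim: k => [_|k IH kn].
    exists 0 => z z0; have -> : z = 0 by apply/rowP => i; rewrite z0// mxE.
    by rewrite !dotE !addr0.
  have [p pP] := IH (ltnW kn).
  pose V := [set z : 'rV[R]_n | forall i : 'I_n, (k <= i)%N -> z 0 i = 0].
  have [||c cP] := @subgradient_step f x p (Ordinal kn) V cf _ _ pP.
  - by move=> z z' a b Vz Vz' i ki; rewrite !mxE Vz// Vz'// !mulr0 addr0.
  - by move=> i _; rewrite mxE.
  pose e : 'rV[R]_n := delta_mx 0 (Ordinal kn).
  (* The slope along [e] has to be [c], whatever [p] prescribes there; hence the subtraction of
     [dot p e]. *)
  exists (p + (c - dot p e) *: e) => z Vz.
  pose z' := z - z 0 (Ordinal kn) *: e.
  have Vz' : V z'.
    move=> i ki; rewrite !mxE/=; case: (eqVneq i (Ordinal kn)) => [->|/= ik].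
      by rewrite mulr1 subrr.
    rewrite mulr0 subr0; apply: Vz; rewrite ltn_neqAle ki andbT.
    by apply: contra ik => /eqP ik; apply/eqP/val_inj.
  have := cP z' (z 0 (Ordinal kn)) Vz'.
  have -> : x + z' + z 0 (Ordinal kn) *: delta_mx 0 (Ordinal kn) = x + z.
    by rewrite /z' /e -addrA subrK.
  rewrite /z' -(dot_delta z) -/e !dotE (dotC e z) => ?; lra.
have [p pP] := H n (leqnn n).
exists p => y; have := pP (y - x); rewrite (addrC x) subrK; apply => i.
by rewrite leqNgt ltn_ord.
Qed.

End Convexity.

Section Legendre.
Variables (R : realType) (n : nat).
Implicit Types (f g h : 'rV[R]_n -> R) (x y z p : 'rV[R]_n) (A : set 'rV[R]_n).

(** [halfsq] is its own Legendre transform, so this bound passes to [legendre f] with the same [M].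
    It is the form in which periodicity enters the convex analysis: it makes the suprema finite and
    confines subgradients. *)
Definition near_halfsq (M : R) f :=
  forall x, halfsq x - M <= f x <= halfsq x + M.

(** The subgradient inequality tested at the point [z = p] itself completes a square. *)
Lemma subgradient_near M f y p : near_halfsq M f ->
  (forall z, f y + dot p (z - y) <= f z) -> halfsq (p - y) <= 2 * M.
Proof.
move=> fM /(_ p); move: (fM p) (fM y) => /andP[_ h1] /andP[h2 _].
by rewrite halfsqB !dotE; rewrite /halfsq in h1 h2 *; lra.
Qed.

Lemma lipschitz_at_cvg (V : normedModType R) (f : V -> R) (K : R) (y : V) :
  (forall z : V, `|y - z| <= 1 -> `|f y - f z| <= K * `|y - z|) ->
  f z @[z --> y] --> f y.
Proof.
move=> fK; apply/cvgrPdist_le => e e0.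
have K0 : 0 < `|K| + 1 by rewrite ltr_wpDl.
have d0 : 0 < Num.min 1 (e / (`|K| + 1)).
  by rewrite lt_min ltr01 divr_gt0.
near=> z; have : `|y - z| <= Num.min 1 (e / (`|K| + 1)).
  near: z; exact: cvgr_dist_le.
rewrite le_min => /andP[z1]; rewrite ler_pdivlMr// => ze.
apply: le_trans (fK _ z1) _; apply: le_trans ze; rewrite mulrC ler_wpM2l//.
by rewrite (le_trans (ler_norm K))// lerDl.
Unshelve. all: by end_near. Qed.

(** A subgradient at [y] lies at bounded distance from [y], so the Lipschitz constant grows only
    linearly in the norm of [y]. *)
Lemma convex_near_lip M f y z : convex_fun f -> near_halfsq M f ->
  f y - f z <= n%:R * ((`|y| + (1 + 4 * M)) * `|y - z|).
Proof.
move=> cf fM; have [p pP] := subgradient_exists y cf.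
have M0 : 0 <= M by have := fM 0; rewrite halfsq0; lra.
have : `|p - y| <= 1 + 4 * M.
  apply: norm_le_of_halfsq; first by lra.
  have := subgradient_near fM pP; have := sqr_ge0 M; nra.
move=> py; have : `|p| <= `|y| + (1 + 4 * M).
  by rewrite -(subrK y p) addrC (le_trans (ler_normD _ _))// lerD2l.
move=> pb; have := pP z; rewrite -opprB dotNr => h.
apply: (@le_trans _ _ (dot p (y - z))); first by lra.
apply: le_trans (ler_norm _) _; apply: le_trans (norm_dot_le _ _) _.
by rewrite ler_wpM2l// ler_wpM2r.
Qed.

Lemma convex_near_continuous M f : convex_fun f -> near_halfsq M f ->
  continuous f.
Proof.
move=> cf fM y.
apply: (@lipschitz_at_cvg _ f (n%:R * (`|y| + 1 + (1 + 4 * M)))) => z yz.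
rewrite -mulrA ler_norml; apply/andP; split.
- rewrite lerNl opprB distrC.
  apply: le_trans (convex_near_lip z y cf fM) _.
  rewrite ler_wpM2l// ler_wpM2r// lerD2r.
  by rewrite -(subrK y z) addrC (le_trans (ler_normD _ _))// lerD2l distrC.
- apply: le_trans (convex_near_lip y z cf fM) _.
  by rewrite ler_wpM2l// ler_wpM2r// lerD2r lerDl.
Qed.

(** With [A = setT] this is convertible to [legendre], and with the minimum set of [H] to the limit
    [psi_infty], so that the same lemmas serve both. *)
Definition legendre_on A g y : R := sup [set dot x y - g x | x in A].

Section LegendreOn.
Variables (A : set 'rV[R]_n) (M : R) (g : 'rV[R]_n -> R).
Hypotheses (A0 : A !=set0) (gM : forall x, halfsq x - M <= g x).

Lemma legendre_on_has_sup y : has_sup [set dot x y - g x | x in A].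
Proof.
split; first exact: image_nonempty.
exists (halfsq y + M) => _ [x _ <-].
by have := gM x; have := halfsq_ge0 (x - y); rewrite halfsqB; lra.
Qed.

Lemma legendre_on_ge x y : A x -> dot x y - g x <= legendre_on A g y.
Proof.
move=> Ax; apply: ub_le_sup; first by case: (legendre_on_has_sup y).
by exists x.
Qed.

Lemma legendre_on_le y c : (forall x, A x -> dot x y - g x <= c) ->
  legendre_on A g y <= c.
Proof.
move=> h; apply: ge_sup; first by case: (legendre_on_has_sup y).
by move=> _ [x Ax <-]; exact: h.
Qed.

Lemma legendre_on_le_halfsq y : legendre_on A g y <= halfsq y + M.
Proof.
apply: legendre_on_le => x _.
by have := gM x; have := halfsq_ge0 (x - y); rewrite halfsqB; lra.
Qed.

Lemma legendre_on_convex : convex_fun (legendre_on A g).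
Proof.
apply/convex_funP => y z t /andP[t0 t1]; apply: legendre_on_le => x Ax.
have h1 := legendre_on_ge y Ax; have h2 := legendre_on_ge z Ax.
rewrite !dotE.
have -> : t * dot x y + (1 - t) * dot x z - g x =
  t * (dot x y - g x) + (1 - t) * (dot x z - g x) by ring.
by rewrite lerD// ler_wpM2l// subr_ge0.
Qed.

End LegendreOn.

Lemma legendre_ge M g x y : near_halfsq M g -> dot x y - g x <= legendre g y.
Proof.
move=> gM; apply: (@legendre_on_ge setT M) => //; first by exists 0.
by move=> z; case/andP: (gM z).
Qed.

Lemma legendre_le M g y c : near_halfsq M g ->
  (forall x, dot x y - g x <= c) -> legendre g y <= c.
Proof.
move=> gM gc; apply: (@legendre_on_le setT M) => //; first by exists 0.
by move=> z; case/andP: (gM z).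
Qed.

Lemma legendre_near M g : near_halfsq M g -> near_halfsq M (legendre g).
Proof.
move=> gM y; apply/andP; split.
  have := legendre_ge y y gM; have /andP[_] := gM y; rewrite /halfsq; lra.
apply: (@legendre_on_le_halfsq setT); first by exists 0.
by move=> z; case/andP: (gM z).
Qed.

Lemma legendre_convex M g : near_halfsq M g -> convex_fun (legendre g).
Proof.
move=> gM; apply: (@legendre_on_convex setT M); first by exists 0.
by move=> z; case/andP: (gM z).
Qed.

Lemma legendre_continuous M g : near_halfsq M g -> continuous (legendre g).
Proof.
by move=> gM; exact: convex_near_continuous (legendre_convex gM) (legendre_near gM).
Qed.

(** A subgradient of [h] at [x] is the competitor for the outer supremum. The set [A] is left
    general because the argument has three uses: the biconjugate theorem, the maximality of the
    convex hull over the minimum set, and the upper bound on the flow. *)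
Lemma convex_le_biconjugate A M M' g h : A !=set0 ->
  (forall x, halfsq x - M <= g x) -> near_halfsq M' (legendre_on A g) ->
  convex_fun h -> (forall x, A x -> h x <= g x) ->
  forall x, h x <= legendre (legendre_on A g) x.
Proof.
move=> A0 gM gM' ch hg x; have [p pP] := subgradient_exists x ch.
apply: le_trans (legendre_ge p x gM').
suff : legendre_on A g p <= dot p x - h x by lra.
apply: legendre_on_le A0 gM _ _ _ => z Az.
by have := pP z; have := hg z Az; rewrite !dotE (dotC z); lra.
Qed.

Lemma biconjugate M f : convex_fun f -> near_halfsq M f ->
  legendre (legendre f) = f.
Proof.
move=> cf fM; apply/funext => x; apply/eqP; rewrite eq_le; apply/andP; split.
  apply: (legendre_le (legendre_near fM)) => y.
  by have := legendre_ge x y fM; rewrite (dotC y); lra.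
apply: (@convex_le_biconjugate setT M M f f) => //; first by exists 0.
  by move=> z; case/andP: (fM z).
exact: legendre_near.
Qed.

Lemma legendre_lipschitz M M' f g c x : near_halfsq M f -> near_halfsq M' g ->
  (forall y, f y <= g y + c) -> legendre g x <= legendre f x + c.
Proof.
move=> fM gM fg; apply: legendre_le gM _ => y.
by have := legendre_ge y x fM; have := fg y; lra.
Qed.

End Legendre.

(** * Lattice periodicity and compactness *)

Section Lattice.
Variables (R : realType) (n : nat) (L : set 'rV[R]_n).
Hypothesis HL : unimodular_lattice L.
Implicit Types (f g : 'rV[R]_n -> R) (x y z l : 'rV[R]_n).

Lemma latticeN l : L l -> L (- l).
Proof.
by case: HL => B _ -> [z ->]; exists (- z); rewrite map_mxN mulNmx.
Qed.

(** Rounding down the coordinates with respect to the basis moves [y] into the fundamental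
    parallelepiped. *)
Lemma lattice_covering :
  exists2 D : R, 0 < D & forall y, exists2 l, L l & `|y + l| <= D.
Proof.
case: HL => B detB ->; have uB : B \in unitmx.
  by rewrite unitmxE unitfE -normr_gt0 detB ltr01.
exists (1 + \sum_i \sum_j `|B i j|) => [|y].
  by rewrite ltr_pwDl// sumr_ge0// => i _; rewrite sumr_ge0.
have [c ->] : exists c, y = c *m B by exists (y *m invmx B); rewrite mulmxKV.
exists (map_mx intr (\row_i - Num.floor (c 0 i)) *m B); first by exists (\row_i - Num.floor (c 0 i)).
rewrite -mulmxDl; apply: norm_le_coord.
  by rewrite ltW// ltr_pwDl// sumr_ge0// => i _; rewrite sumr_ge0.
move=> j; rewrite mxE; apply: le_trans (ler_norm_sum _ _ _) _.
apply: ler_wpDl; first exact: ler01.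
apply: ler_sum => i _; rewrite normrM !mxE.
have h : `|c 0 i + (- Num.floor (c 0 i))%:~R| <= 1.
  rewrite rmorphN/= ger0_norm ?subr_ge0 ?ge_floor//.
  by rewrite lerBlDl ltW//; have := floorD1_gt (c 0 i); rewrite intrD.
rewrite (bigD1 j)//= -[leLHS]addr0 lerD ?sumr_ge0//.
by rewrite -[leRHS]mul1r ler_wpM2r.
Qed.

(** The hypothesis at plus and minus each basis vector bounds the pairings of [u] with the basis,
    and the inverse matrix recovers [u] from them. *)
Lemma lattice_separating :
  exists C : R, forall u, (forall l, L l -> dot u l <= halfsq l) ->
    halfsq u <= C.
Proof.
case: HL => B detB LE; have uB : B \in unitmx.
  by rewrite unitmxE unitfE -normr_gt0 detB ltr01.
pose b i := row i B; pose V := invmx B^T.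
have Lb i : L (b i).
  by rewrite LE; exists (delta_mx 0 i); rewrite /b rowE map_delta_mx.
pose K j := \sum_i halfsq (b i) * `|V i j|.
exists ((\sum_j K j ^+ 2) / 2) => u ub.
rewrite /halfsq ler_pM2r ?invr_gt0// /dot ler_sum// => j _.
rewrite -expr2 -real_normK ?num_real// ler_pXn2r ?nnegrE//; last first.
  by apply: sumr_ge0 => i _; rewrite mulr_ge0// halfsq_ge0.
have -> : u = (u *m B^T) *m V by rewrite mulmxK// unitmx_tr.
rewrite mxE; apply: le_trans (ler_norm_sum _ _ _) _.
apply: ler_sum => i _; rewrite normrM ler_wpM2r//.
have -> : (u *m B^T) 0 i = dot u (b i).
  by rewrite mxE; apply: eq_bigr => k _; rewrite !mxE.
rewrite ler_norml; apply/andP; split; last exact: ub.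
by rewrite lerNl -dotNr -halfsqN ub//; exact: latticeN.
Qed.

Lemma CL_shift f x l : CL L f -> L l -> f (x + l) = f x + dot x l + halfsq l.
Proof.
move=> [_ pf] Ll; have := pf x l Ll; rewrite -!/(halfsq _) halfsqD; lra.
Qed.

(* A subgradient [p] at [y], tested at the points [y + l], satisfies
   [dot (p - y) l <= halfsq l] for every lattice vector [l]; hence [p - y] is
   bounded. *)
Lemma CL_near f : CL L f -> exists M, near_halfsq M f.
Proof.
move=> cf; have [D D0 Dcov] := lattice_covering.
have [C CP] := lattice_separating.
have sub y p : (forall z, f y + dot p (z - y) <= f z) -> halfsq (p - y) <= C.
  move=> pP; apply: CP => l Ll; have := pP (y + l); rewrite (CL_shift _ cf Ll).
  by rewrite addrAC subrr add0r !dotE; lra.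
(* On the ball of radius [D], a subgradient at 0 bounds [f] from below, and a subgradient at [y],
   tested at 0, bounds it from above; [E] and [E'] bound the two pairings. *)
have [p0 p0P] := subgradient_exists 0 cf.1.
pose E := n%:R * (`|p0| * D).
pose E' := n%:R * ((D + (1 + 2 * `|C|)) * D).
exists (`|f 0| + E + E' + n%:R * (D * D)) => x.
have [l Ll xl] := Dcov x; set y := x + l in xl.
have -> : x = y - l by rewrite /y addrK.
rewrite (CL_shift _ cf (latticeN Ll)) halfsqD.
have -> : halfsq y + dot y (- l) + halfsq (- l) - (`|f 0| + E + E' + n%:R * (D * D)) =
  (halfsq y - (`|f 0| + E + E' + n%:R * (D * D))) + dot y (- l) + halfsq (- l) by ring.
have -> : halfsq y + dot y (- l) + halfsq (- l) + (`|f 0| + E + E' + n%:R * (D * D)) =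
  (halfsq y + (`|f 0| + E + E' + n%:R * (D * D))) + dot y (- l) + halfsq (- l) by ring.
rewrite !lerD2r.
have hy := halfsq_ge0 y.
have hy2 : halfsq y <= n%:R * (D * D).
  have : dot y y <= n%:R * (D * D).
    apply: le_trans (ler_norm _) _; apply: le_trans (norm_dot_le _ _) _.
    by rewrite ler_wpM2l// ler_pM.
  by have := dot_ge0 y; rewrite /halfsq; lra.
have dotD p c : `|p| <= c -> `|dot p y| <= n%:R * (c * D).
  move=> pc; apply: le_trans (norm_dot_le _ _) _.
  by rewrite ler_wpM2l// ler_pM.
have h1 := dotD p0 _ (lexx _); rewrite -/E in h1.
have [p pP] := subgradient_exists y cf.1.
have pE : `|p| <= D + (1 + 2 * `|C|).
  rewrite -(subrK y p) addrC (le_trans (ler_normD _ _))// lerD//.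
  apply: norm_le_of_halfsq; first by rewrite ltr_pwDl// mulr_ge0.
  have := sub y p pP; have := ler_norm C; have := sqr_ge0 `|C|.
  by move: (`|C|) => c; nra.
have h2 := dotD p _ pE; rewrite -/E' in h2.
move: h1 h2; rewrite !ler_norml => /andP[h11 h12] /andP[h21 h22].
have := p0P y; rewrite subr0 => h3; have := pP 0; rewrite sub0r dotNr => h4.
have := ler_norm (f 0); have := ler_norm (- f 0); rewrite normrN => h5 h6.
have E0 : 0 <= E by rewrite !mulr_ge0// ltW.
have E0' : 0 <= E'.
  by have C0 := normr_ge0 C; rewrite /E' mulr_ge0// mulr_ge0//; lra.
by apply/andP; split; lra.
Qed.

(** Shifting the competitor by [l] gives one inequality; the same inequality at [y + l] for the
    vector [- l] is its converse. *)
Lemma periodic_legendre_on (A : set 'rV[R]_n) M g : A !=set0 ->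
  (forall x, halfsq x - M <= g x) ->
  (forall x l, L l -> A x -> A (x + l)) ->
  periodic L (fun x => g x - dot x x / 2) ->
  periodic L (fun y => legendre_on A g y - dot y y / 2).
Proof.
move=> A0 gM AL pg.
have le y l : L l ->
    legendre_on A g y + dot y l + halfsq l <= legendre_on A g (y + l).
  move=> Ll; suff : legendre_on A g y <= legendre_on A g (y + l) - dot y l - halfsq l by lra.
  apply: (legendre_on_le A0 gM) => x Ax.
  have := legendre_on_ge A0 gM (y + l) (AL _ _ Ll Ax).
  have := pg x l Ll; rewrite -!/(halfsq _) halfsqD !dotE (dotC l y) /halfsq; lra.
move=> y l Ll; rewrite -!/(halfsq _).
have h1 := le y l Ll; have := le (y + l) (- l) (latticeN Ll).
by rewrite addrK !dotE halfsqN halfsqD; rewrite /halfsq in h1 *; lra.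
Qed.

End Lattice.

(** * Compactness modulo the lattice, and maxima over space-time *)

Section Compactness.
Variables (R : realType).

(** The second point may leave [K]: of two nearby points, a lattice translation is sure to bring
    only one into the compact set. *)
Lemma compact_uniform (V : normedModType R) (K : set V) (f : V -> R) (e : R) :
  compact K -> continuous f -> 0 < e ->
  exists2 d, 0 < d & forall x y, K x -> `|x - y| <= d -> `|f x - f y| <= e.
Proof.
move=> cK cf e0.
have := (compact_near_coveringP K).1 cK R (0:R)^'+
  (fun d x => forall y, `|x - y| <= d -> `|f x - f y| <= e) _.
move=> [|d0 /= d00 dP].
  move=> x Kx.
  have e2 : 0 < e / 2 by rewrite divr_gt0.
  have /cvgrPdist_le/(_ _ e2) := cf x.
  move=> /nbhs_normP[r /= r0 rP].
  exists (ball x (r / 2), [set d | 0 < d < r / 2]); first split => /=.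
  - by apply: nbhsx_ballx; rewrite divr_gt0.
  - exists (r / 2) => /=; first by rewrite divr_gt0.
    by move=> d; rewrite /= sub0r normrN => dr d0; rewrite d0 (le_lt_trans _ dr)// ler_norm.
  move=> [x' d] [/= xx' /andP[d0 dr]] y yd.
  rewrite -ball_normE /= in xx'.
  have h1 : `|f x - f x'| <= e / 2.
    by apply: rP => /=; lra.
  have h2 : `|f x - f y| <= e / 2.
    apply: rP => /=; rewrite -(subrK x' x) -addrA (le_lt_trans (ler_normD _ _))//.
    by have := le_lt_trans yd dr; lra.
  rewrite -(subrK (f x) (f x')) -addrA (le_trans (ler_normD _ _))// distrC.
  by lra.
exists (d0 / 2); first by rewrite divr_gt0.
move=> x y Kx; apply: (dP (d0 / 2)) Kx _ => //=; last by rewrite divr_gt0.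
by rewrite sub0r normrN gtr0_norm ?divr_gt0// ltr_pdivrMr// ltr_pMr// ltr1n.
Qed.

Lemma compact_norm_le n (D : R) : compact [set x : 'rV[R]_n | `|x| <= D].
Proof.
apply: bounded_closed_compact.
  by exists D; split; rewrite ?num_real// => c Dc x /= xD; rewrite (le_trans xD)// ltW.
apply: (@preimage_closed _ _ (fun x : 'rV[R]_n => `|x|) [set r | r <= D]).
  by move=> x _; exact: norm_continuous.
exact: closed_le.
Qed.

(** The last hypothesis replaces compactness of [E]. It is met by lattice translation, by decay of
    [F], or by a combination of both. *)
Lemma attains_max (E : topologicalType) (F : R -> E -> R) (K : set E) (T : R) :
  compact K -> K !=set0 -> 0 <= T ->
  continuous (fun p : R * E => F p.1 p.2) ->
  (forall t e, 0 <= t <= T -> exists2 e', K e' & F t e <= F t e') ->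
  exists t0 e0, [/\ 0 <= t0 <= T, K e0 &
    forall t e, 0 <= t <= T -> F t e <= F t0 e0].
Proof.
move=> cK [k Kk] T0 cF FK.
have cX : compact (`[0, T]%classic `*` K) by apply: compact_setX => //; exact: segment_compact.
have X0 : (`[0, T]%classic `*` K) !=set0.
  by exists (0, k); split => //=; rewrite in_itv/= lexx.
have [|[t0 e0]] := compact_EVT_max (f := fun p : R * E => F p.1 p.2) X0 cX.
  exact: continuous_subspaceT.
rewrite inE => -[/=]; rewrite in_itv/= => t0T Ke0 mx.
exists t0, e0; split => // t e tT; have [e' Ke' /le_trans] := FK t e tT; apply.
by apply: (mx (t, e')); rewrite inE; split => //=; rewrite in_itv.
Qed.

(* The term [C * t ^+ N.+1] is negligible at [t1] and large at [2 * t1], which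
   keeps the maximum away from the final time. *)
Lemma time_max (E : topologicalType) (F : R -> E -> R) (K : set E)
    (m0 eta t1 : R) :
  compact K -> K !=set0 -> 0 < eta -> 0 < t1 ->
  continuous (fun p : R * E => F p.1 p.2) ->
  (forall t e, 0 <= t <= 2 * t1 -> exists2 e', K e' & F t e <= F t e') ->
  (forall e, F 0 e <= m0) ->
  (forall (C : R) (N : nat) t0 e0, 0 <= C -> 0 < t0 < 2 * t1 ->
    m0 < F t0 e0 - (eta * t0 + C * t0 ^+ N.+1) ->
    (forall t e, 0 <= t <= 2 * t1 ->
      F t e - (eta * t + C * t ^+ N.+1) <=
      F t0 e0 - (eta * t0 + C * t0 ^+ N.+1)) -> False) ->
  forall e, F t1 e <= m0 + eta * t1.
Proof.
move=> cK K0 eta0 t10 cF FK F0 noint e1; apply/negPn/negP; rewrite -ltNge => gap.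
pose T := 2 * t1; have T0 : 0 < T by rewrite mulr_gt0.
have [tB [eB [_ _]]] := attains_max cK K0 (ltW T0) cF FK.
set B := F tB eB => FB.
(* [gam] is the amount by which the claim fails. The coefficient [C] makes the power term equal to
   [K'] at the final time [T], more than [F] can gain over [F t1 e1]; since [t1] is half of [T], a
   large exponent makes it at most [gam / 2] at [t1]. *)
pose gam := F t1 e1 - (m0 + eta * t1).
have gam0 : 0 < gam by rewrite subr_gt0.
pose K' := `|B - F t1 e1| + gam.
have K'0 : 0 < K' by rewrite ltr_wpDl.
have [N NP] : exists N, K' / gam <= 2 ^+ N.
  exists (Num.bound (K' / gam)).
  apply: le_trans (ltW (archi_boundP _)) _; first by rewrite ltW// divr_gt0.
  by rewrite -natrX ler_nat ltnW// ltn_expl.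
pose C := K' / T ^+ N.+1.
have TN0 : 0 < T ^+ N.+1 by rewrite exprn_gt0.
have C0 : 0 < C by rewrite divr_gt0.
have CT : C * T ^+ N.+1 = K' by rewrite /C divfK// gt_eqF.
have Ct1 : C * t1 ^+ N.+1 <= gam / 2.
  have -> : C * t1 ^+ N.+1 = K' / 2 ^+ N.+1.
    by rewrite /C /T exprMn invfM mulrA divfK// expf_neq0// gt_eqF.
  rewrite exprS invfM mulrCA mulrC ler_pM2r ?invr_gt0//.
  by rewrite ler_pdivrMr ?exprn_gt0// mulrC -ler_pdivrMr.
pose g t := eta * t + C * t ^+ N.+1.
have cg : continuous g.
  apply: continuous_addf; apply: continuous_mulf; try exact: cst_continuous.
    by move=> t; exact: cvg_id.
  exact: exprn_continuous.
pose G t e := F t e - g t.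
have cG : continuous (fun p : R * E => G p.1 p.2).
  move=> p; apply: cvgB; first exact: cF.
  by apply: (continuous_comp (g := g)); [exact: cvg_fst|exact: cg].
have GK t e : 0 <= t <= 2 * t1 -> exists2 e', K e' & G t e <= G t e'.
  by move=> /(FK _ e)[e' Ke' h]; exists e' => //; rewrite lerD2r.
have [t0 [e0 [/andP[t00 t0T] _ mx]]] := attains_max cK K0 (ltW T0) cG GK.
have t1T : 0 <= t1 <= 2 * t1 by rewrite ltW//=; lra.
have G1 : m0 < G t1 e1.
  by rewrite /G /g; rewrite /gam in gam0 Ct1; lra.
have Gm : m0 < G t0 e0 by exact: lt_le_trans G1 (mx _ _ t1T).
apply: (noint C N t0 e0) => //; first exact: ltW.
have t0n0 : t0 != 0.
  apply: contraTneq Gm => ->; rewrite -leNgt /G /g expr0n/= !mulr0 addr0 subr0.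
  exact: F0.
have -> /= : 0 < t0 by rewrite lt_neqAle eq_sym t0n0.
rewrite lt_neqAle t0T andbT.
apply: contraTneq (mx _ e1 t1T) => t0E; rewrite -ltNge.
rewrite /G t0E -/T {1}/g CT; have := FB T e0; rewrite lexx ltW// => /(_ isT) h.
have := ler_norm (B - F t1 e1); rewrite /g; rewrite /K' /gam in CT Ct1 *.
have : eta * t1 <= eta * T by rewrite ler_pM2l// /T; lra.
lra.
Qed.

Variables (n : nat) (L : set 'rV[R]_n).
Hypothesis HL : unimodular_lattice L.

Lemma periodic_uniform (g : R -> 'rV[R]_n -> R) (T e : R) :
  continuous (fun p : R * 'rV[R]_n => g p.1 p.2) ->
  (forall t, 0 <= t <= T -> periodic L (g t)) -> 0 < e ->
  exists2 d, 0 < d & forall t s y z, 0 <= t <= T -> 0 <= s <= T ->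
    `|t - s| <= d -> `|y - z| <= d -> `|g t y - g s z| <= e.
Proof.
move=> cg pg e0; have [D D0 DP] := lattice_covering HL.
pose K := `[0, T]%classic `*` [set x : 'rV[R]_n | `|x| <= D].
have cK : compact K.
  by apply: compact_setX; [exact: segment_compact | exact: compact_norm_le].
have [d d0 dP] := compact_uniform cK cg e0.
exists d => // t s y z tT sT ts yz; have [l Ll yl] := DP y.
rewrite -(pg t tT y l Ll) -(pg s sT z l Ll).
apply: (dP (t, y + l) (s, z + l)); first by split => //=; rewrite in_itv.
rewrite prod_normE/= ge_max ts/=.
by rewrite opprD addrACA subrr addr0.
Qed.

Lemma periodic_bounded (g : R -> 'rV[R]_n -> R) (T : R) :
  continuous (fun p : R * 'rV[R]_n => g p.1 p.2) ->
  (forall t, 0 <= t <= T -> periodic L (g t)) ->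
  exists C, forall t y, 0 <= t <= T -> `|g t y| <= C.
Proof.
move=> cg pg; have [D D0 DP] := lattice_covering HL.
have [T0|T0] := leP 0 T; last by exists 0 => t y /andP[a b]; lra.
pose F t y := `|g t y|.
have [|||t0 [e0 [_ _ mx]]] := @attains_max 'rV[R]_n F [set x | `|x| <= D] T
    (@compact_norm_le n D) _ T0.
- by exists 0; rewrite /= normr0 ltW.
- by move=> p; apply: (continuous_comp _ (@norm_continuous _ _ _)); exact: cg.
- move=> t y tT; have [l Ll yl] := DP y; exists (y + l) => //.
  by rewrite /F pg.
- by exists (F t0 e0).
Qed.

End Compactness.

Section Periodic.
Variables (R : realType) (n : nat) (L : set 'rV[R]_n).
Hypothesis HL : unimodular_lattice L.

Lemma periodic_uniform1 (g : 'rV[R]_n -> R) (e : R) : continuous g ->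
  periodic L g -> 0 < e ->
  exists2 d, 0 < d & forall y z, `|y - z| <= d -> `|g y - g z| <= e.
Proof.
move=> cg pg e0; have [||d d0 dP] := @periodic_uniform R n L HL (fun=> g) 1 e _ _ e0.
- by move=> p; apply: (continuous_comp _ (cg _)); exact: cvg_snd.
- by [].
exists d => // y z; apply: (dP 0 0); rewrite ?lexx ?ler01//.
by rewrite subrr normr0 ltW.
Qed.

Lemma periodic_bounded1 (g : 'rV[R]_n -> R) : continuous g ->
  periodic L g -> exists C, forall y, `|g y| <= C.
Proof.
move=> cg pg; have [||C CP] := @periodic_bounded R n L HL (fun=> g) 1.
- by move=> p; apply: (continuous_comp _ (cg _)); exact: cvg_snd.
- by [].
by exists C => y; apply: (CP 0); rewrite lexx ler01.
Qed.

End Periodic.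

(** * Directional derivatives *)

Section LineDerivatives.
Variables (R : realType) (V : normedModType R).
Implicit Types (f g : V -> R) (x v u : V).

Lemma is_derive_lineP f x v (a : R) :
  is_derive x v f a <-> is_derive (0 : R) 1 (fun h : R => f (h *: v + x)) a.
Proof.
have E : (fun h : R => h^-1 *: ((f \o shift x) (h *: v) - f x)) =
  (fun h : R => h^-1 *: (((fun h : R => f (h *: v + x)) \o shift 0) (h *: 1) -
     f ((0 : R) *: v + x))).
  by apply/funext => h /=; rewrite addr0 scale0r add0r [h *: 1]mulr1.
split=> -[df <-].
- by split; [rewrite /derivable -E | rewrite /derive -E].
- by split; [rewrite /derivable E | rewrite /derive E].
Qed.

Lemma is_derive_shift_line f x v (a s : R) :
  is_derive (s *: v + x) v f a <-> is_derive s 1 (fun h : R => f (h *: v + x)) a.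
Proof.
have E : (fun h : R => h^-1 *: ((f \o shift (s *: v + x)) (h *: v) - f (s *: v + x))) =
  (fun h : R => h^-1 *: (((fun h : R => f (h *: v + x)) \o shift s) (h *: 1) -
     f (s *: v + x))).
  by apply/funext => h /=; rewrite [h *: 1]mulr1 scalerDl addrA.
split=> -[df <-].
- by split; [rewrite /derivable -E | rewrite /derive -E].
- by split; [rewrite /derivable E | rewrite /derive E].
Qed.

Lemma is_derive_quadratic f x v (a b : R) :
  (forall h : R, f (h *: v + x) = f x + h * a + h ^+ 2 * b) ->
  is_derive x v f a.
Proof.
move=> H; apply/is_derive_lineP.
have -> : (fun h : R => f (h *: v + x)) = (fun h : R => f x + h * a + h ^+ 2 * b).
  exact/funext.
apply: is_derive_eq.
by rewrite /GRing.scale/=; ring.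
Qed.

(** One-sided on purpose: along a segment going back in time only positive [h] are compared. *)
Lemma derive_le_right (k : R -> R) (c m d : R) : 0 < d ->
  is_derive (0 : R) 1 k c ->
  (forall h, 0 < h < d -> k h - k 0 <= h * m) -> c <= m.
Proof.
move=> d0 -[dk kc] km; apply/negPn/negP; rewrite -ltNge => mc.
have : \forall h \near (0 : R)^', m < h^-1 *: ((k \o shift 0) (h *: 1) - k 0).
  by apply: cvgr_gt mc; rewrite -kc; exact: dk.
move=> /nbhs_ballP[e /= e0 eP].
have md0 : 0 < Num.min d e by rewrite lt_min d0.
pose h := Num.min d e / 2.
have h0 : 0 < h by rewrite divr_gt0.
have hm : h < Num.min d e by rewrite ltr_pdivrMr// ltr_pMr// ltr1n.
move: (hm); rewrite lt_min => /andP[hd he].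
have := eP h _ (lt0r_neq0 h0); rewrite -ball_normE /= sub0r normrN gtr0_norm//.
move=> /(_ he); rewrite addr0 [h *: 1]mulr1 [_ *: _]mulrC ltr_pdivlMr//.
by rewrite mulrC ltNge km// h0.
Qed.

Lemma is_derive_reflect (k : R -> R) (c : R) : is_derive (0 : R) 1 k c ->
  is_derive (0 : R) 1 (fun h => k (- h)) (- c).
Proof.
move=> dk; rewrite -[- c]mulrN1.
apply: (@is_derive1_comp _ k (fun h => - h)); first by rewrite oppr0.
Qed.

Lemma derive_eq0_at_min (k : R -> R) (c d : R) : 0 < d ->
  is_derive (0 : R) 1 k c -> (forall h, `|h| < d -> k 0 <= k h) -> c = 0.
Proof.
move=> d0 dk kmin; apply/eqP; rewrite eq_le; apply/andP; split.
  rewrite -oppr_ge0 -oppr_le0 opprK.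
  have dk' := is_deriveN (is_derive_reflect dk); rewrite opprK in dk'.
  apply: (derive_le_right d0 dk') => h /andP[h0 hd] /=.
  by rewrite mulr0 fctE /= oppr0 opprK addrC subr_le0 kmin// normrN gtr0_norm.
rewrite -oppr_le0; apply: (derive_le_right d0 (is_deriveN dk)) => h /andP[h0 hd] /=.
by rewrite mulr0 !fctE /= opprK addrC subr_le0 kmin// gtr0_norm.
Qed.

(** A negative [c] would make [k'] negative just to the right of 0, and by the mean value theorem
    [k] would drop below [k 0]. *)
Lemma second_derive_ge0 (k k' : R -> R) (c : R) :
  (forall s : R, is_derive s 1 k (k' s)) -> is_derive (0 : R) 1 k' c ->
  (forall h, k 0 <= k h) -> 0 <= c.
Proof.
move=> dk dk' kmin.
have k'0 : k' 0 = 0.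
  by apply: (derive_eq0_at_min ltr01 (dk 0)) => h _; exact: kmin.
apply/negPn/negP; rewrite -ltNge => c0.
have [d d0 dP] : exists2 d, 0 < d & forall h, 0 < h < d -> k' h < 0.
  case: dk' => dk' kc.
  have : \forall h \near (0 : R)^', h^-1 *: ((k' \o shift 0) (h *: 1) - k' 0) < 0.
    by apply: cvgr_lt c0; rewrite -kc; exact: dk'.
  move=> /nbhs_ballP[e /= e0 eP]; exists e => // h /andP[h0 he].
  have := eP h _ (lt0r_neq0 h0); rewrite -ball_normE /= sub0r normrN gtr0_norm//.
  move=> /(_ he); rewrite addr0 [h *: 1]mulr1 k'0 subr0 [_ *: _]mulrC.
  by rewrite pmulr_llt0// invr_gt0.
have d20 : 0 < d / 2 by rewrite divr_gt0.
have [|s] := @MVT R k k' 0 (d / 2) d20 (fun t _ => dk t).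
  apply: continuous_subspaceT => t; apply: differentiable_continuous.
  by apply/derivable1_diffP; case: (dk t).
rewrite in_itv /= => /andP[s0 sd] E.
have := kmin (d / 2); rewrite -subr_ge0 E subr0 pmulr_lge0// leNgt dP// s0 /=.
by apply: lt_trans sd _; rewrite ltr_pdivrMr// ltr_pMr// ltr1n.
Qed.

Lemma MVT_line f x v (h : R) : 0 < h -> (forall y, derivable f y v) ->
  exists2 s, 0 < s < h & f (h *: v + x) - f x = h * 'D_v f (s *: v + x).
Proof.
move=> h0 df.
have dk (s : R) : is_derive s 1 (fun h : R => f (h *: v + x)) ('D_v f (s *: v + x)).
  by apply/is_derive_shift_line; split.
have [|s] := @MVT R (fun h => f (h *: v + x)) (fun h => 'D_v f (h *: v + x)) 0 h h0
  (fun t _ => dk t).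
  apply: continuous_subspaceT => t; apply: differentiable_continuous.
  by apply/derivable1_diffP; case: (dk t).
by rewrite in_itv/= scale0r add0r subr0 mulrC => sh E; exists s.
Qed.

(* Both mixed derivatives are limits of the same second difference quotient. *)
Lemma second_difference f x u v (h : R) : 0 < h ->
  (forall y, derivable f y u) -> (forall y, derivable ('D_u f) y v) ->
  exists s r, [/\ 0 < s < h, 0 < r < h &
    f (h *: u + (h *: v + x)) - f (h *: v + x) - (f (h *: u + x) - f x) =
    h ^+ 2 * 'D_v ('D_u f) (r *: v + (s *: u + x))].
Proof.
move=> h0 df ddf.
pose g y := f (h *: v + y) - f y.
have dg y : is_derive y u g ('D_u f (h *: v + y) - 'D_u f y).
  apply: is_deriveB; last exact: derivableP.
  apply/is_derive_lineP.
  have -> : (fun h0 : R => f (h *: v + (h0 *: u + y))) =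
      (fun h0 => f (h0 *: u + (h *: v + y))).
    by apply/funext => t; rewrite addrCA.
  by apply/is_derive_lineP/derivableP.
have [s sh gE] := MVT_line x h0 (fun y => @ex_derive _ _ _ _ _ _ _ (dg y)).
have [r rh E] := MVT_line (s *: u + x) h0 ddf.
exists s, r; split => //.
move: gE; rewrite (@derive_val _ _ _ _ _ _ _ (dg _)) E /g => gE.
rewrite expr2 -mulrA -gE (addrCA (h *: u)); ring.
Qed.

Lemma derive_symmetric f x u v :
  (forall y, derivable f y u) -> (forall y, derivable f y v) ->
  (forall y, derivable ('D_u f) y v) -> (forall y, derivable ('D_v f) y u) ->
  {for x, continuous ('D_v ('D_u f))} -> {for x, continuous ('D_u ('D_v f))} ->
  'D_v ('D_u f) x = 'D_u ('D_v f) x.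
Proof.
have dist (a b c e : R) : `|a - c| < e / 2 -> `|b - c| < e / 2 -> `|a - b| < e.
  by have := ler_distD c a b; rewrite (distrC c b) => *; lra.
move=> du dv duv dvu cuv cvu; apply/eqP/negPn/negP.
rewrite -subr_eq0 -normr_gt0; set e := `|_| => e0.
have e2 : 0 < e / 2 by rewrite divr_gt0.
have /cvgrPdist_lt/(_ _ e2)/nbhs_normP[d1 /= d10 d1P] := cuv.
have /cvgrPdist_lt/(_ _ e2)/nbhs_normP[d2 /= d20 d2P] := cvu.
pose B := `|u| + `|v| + 1; have B0 : 0 < B by rewrite ltr_wpDl// addr_ge0.
pose d := Num.min d1 d2; have d0 : 0 < d by rewrite lt_min d10.
have dd1 : d <= d1 by rewrite ge_min lexx.
have dd2 : d <= d2 by rewrite ge_min lexx orbT.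
pose h := d / B; have h0 : 0 < h by rewrite divr_gt0.
have small s r a b : 0 < s < h -> 0 < r < h -> `|a| + `|b| < B ->
    `|x - (r *: b + (s *: a + x))| < d.
  move=> /andP[s0 sh] /andP[r0 rh] abB.
  rewrite addrA opprD addrCA subrr addr0 normrN.
  apply: le_lt_trans (ler_normD _ _) _; rewrite !normrZ !gtr0_norm//.
  apply: (@le_lt_trans _ _ (h * (`|a| + `|b|))).
    by rewrite mulrDr addrC lerD// ler_wpM2r// ltW.
  by rewrite mulrC -ltr_pdivlMr// -[ltRHS]mulr1 /h invfM invrK mulrA divff ?mul1r ?mulr1// gt_eqF.
have [s [r [sh rh E1]]] := second_difference x h0 du duv.
have [s' [r' [sh' rh' E2]]] := second_difference x h0 dv dvu.
have : 'D_v ('D_u f) (r *: v + (s *: u + x)) = 'D_u ('D_v f) (r' *: u + (s' *: v + x)).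
  apply: (@mulfI _ (h ^+ 2)); first by rewrite expf_neq0// gt_eqF.
  have comm (a1 a2 a3 a4 : R) : a1 - a2 - (a3 - a4) = a1 - a3 - (a2 - a4) by ring.
  apply: etrans (esym E1) _; apply: etrans E2.
  by rewrite (addrCA (h *: u)); exact: comm.
have h1 := d1P (r *: v + (s *: u + x)) _.
have h2 := d2P (r' *: u + (s' *: v + x)) _.
have {}h1 := h1 (lt_le_trans (small _ _ _ _ sh rh _) dd1).
have {}h2 := h2 (lt_le_trans (small _ _ _ _ sh' rh' _) dd2).
move=> E; rewrite /= E in h1.
have {}h1 : `|'D_v ('D_u f) x - 'D_u ('D_v f) (r' *: u + (s' *: v + x))| < e / 2.
  by apply: h1; rewrite ltrDl.
have {}h2 : `|'D_u ('D_v f) x - 'D_u ('D_v f) (r' *: u + (s' *: v + x))| < e / 2.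
  by apply: h2; rewrite addrC ltrDl.
have : e < e := dist _ _ _ _ h1 h2.
by rewrite ltxx.
Qed.

End LineDerivatives.

(** * Derivatives on space-time and on its slices *)

Section Slices.
Variables (R : realType) (n : nat).
Implicit Types (f : R * 'rV[R]_n -> R) (t : R) (y w : 'rV[R]_n).

(** A substitute for the square root that linear arithmetic can use; it is the source of the
    constants [1 + 2 * c], [1 + 4 * M1] and [1 + 8 * M1] below. *)
Lemma norm_le_halfsq (x : 'rV[R]_n) : `|x| <= 1 + 2 * halfsq x.
Proof.
have h0 := halfsq_ge0 x; apply: norm_le_of_halfsq; first by lra.
by have := sqr_ge0 (halfsq x); nra.
Qed.

Lemma pair_time_shift (h t : R) y :
  h *: (1, 0) + (t, y) = (h *: 1 + t, y) :> R * 'rV[R]_n.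
Proof.
have -> : (h *: 1 + t, y) = (h *: 1 + t, h *: 0 + y) by rewrite scaler0 add0r.
by [].
Qed.

Lemma pair_space_shift (h t : R) y w :
  h *: (0, w) + (t, y) = (t, h *: w + y) :> R * 'rV[R]_n.
Proof.
have -> : (t, h *: w + y) = (h *: 0 + t, h *: w + y) by rewrite scaler0 add0r.
by [].
Qed.

Lemma is_derive_time f t y (a : R) :
  is_derive (t, y) (1, 0) f a <-> is_derive t 1 (fun s => f (s, y)) a.
Proof.
have E : (fun h : R => h^-1 *: ((f \o shift (t, y)) (h *: (1, 0)) - f (t, y))) =
  (fun h : R => h^-1 *: (((fun s => f (s, y)) \o shift t) (h *: 1) - f (t, y))).
  by apply/funext => h; rewrite /shift /comp pair_time_shift.
split=> -[df <-].
- by split; [rewrite /derivable -E | rewrite /derive -E].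
- by split; [rewrite /derivable E | rewrite /derive E].
Qed.

Lemma is_derive_space f t y w (a : R) :
  is_derive (t, y) (0, w) f a <-> is_derive y w (fun z => f (t, z)) a.
Proof.
have E : (fun h : R => h^-1 *: ((f \o shift (t, y)) (h *: (0, w)) - f (t, y))) =
  (fun h : R => h^-1 *: (((fun z => f (t, z)) \o shift y) (h *: w) - f (t, y))).
  by apply/funext => h; rewrite /shift /comp pair_space_shift.
split=> -[df <-].
- by split; [rewrite /derivable -E | rewrite /derive -E].
- by split; [rewrite /derivable E | rewrite /derive E].
Qed.

Lemma derive_coord (g : 'rV[R]_n -> R) y w : differentiable g y ->
  'D_w g y = \sum_i w 0 i * 'D_(delta_mx 0 i) g y.
Proof.
move=> dg; rewrite deriveE// [in LHS](row_sum_delta w) linear_sum.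
by apply: eq_bigr => i _; rewrite linearZ deriveE.
Qed.

Lemma derive_time_grad f t y (tau : R) w : differentiable f (t, y) ->
  'D_(tau, w) f (t, y) =
  tau * derive1 (fun s => f (s, y)) t + dot (grad (fun z => f (t, z)) y) w.
Proof.
move=> df; have dd v : is_derive (t, y) v f ('D_v f (t, y)).
  exact/derivableP/diff_derivable.
have E : (tau, w) = tau *: (1, 0) + (0, w) :> R * 'rV[R]_n.
  rewrite /GRing.scale/= /GRing.add/= /add_pair /scale_pair/=.
  by rewrite scaler0 addr0 add0r [_ *: _]mulr1.
have [_ e1] := (is_derive_time f t y _).1 (dd (1, 0)); rewrite derive1E e1.
rewrite deriveE// E linearD linearZ; congr (_ + _); first by rewrite deriveE.
have -> : (0, w) = \sum_i w 0 i *: (0, delta_mx 0 i) :> R * 'rV[R]_n.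
  apply/pair_eqP; apply/andP; split; apply/eqP.
    rewrite (big_morph fst (id1 := 0) (op1 := +%R))//= big1// => i _.
    by rewrite scaler0.
  rewrite (big_morph snd (id1 := 0) (op1 := +%R))//=.
  exact: row_sum_delta.
rewrite linear_sum; apply: eq_bigr => i _.
rewrite linearZ mxE mulrC; congr (_ * _).
have [_ ->] := (is_derive_space f t y _ _).1 (dd (0, delta_mx 0 i)).
by rewrite deriveE.
Qed.

Lemma grad_quadratic (g : 'rV[R]_n -> R) y p (b : 'rV[R]_n -> R) :
  (forall (h : R) w, g (h *: w + y) = g y + h * dot p w + h ^+ 2 * b w) ->
  grad g y = p.
Proof.
move=> H; apply/rowP => i; rewrite mxE -dot_delta.
by have [] := is_derive_quadratic (fun h => H h (delta_mx 0 i)).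
Qed.

Lemma near_line (V : normedModType R) (P : V -> Prop) (x v : V) :
  (\forall z \near x, P z) ->
  exists2 d : R, 0 < d & forall h : R, `|h| < d -> P (h *: v + x).
Proof.
move=> /nbhs_normP[r /= r0 rP].
have v0 : 0 < `|v| + 1 by rewrite ltr_wpDl.
exists (r / (`|v| + 1)); first by rewrite divr_gt0.
move=> h; rewrite ltr_pdivlMr// => hr; apply: rP => /=.
rewrite opprD addrCA subrr addr0 normrN normrZ.
by apply: le_lt_trans hr; rewrite ler_wpM2l// lerDl.
Qed.

End Slices.

(** * Test functions of class C1 *)

Section C1.
Variables (R : realType) (V : normedModType R).
Implicit Types (f g : V -> R).

Lemma C1_on_cst (c : R) : C1_on [set: V] (cst c).
Proof.
move=> x _; split=> [|v]; first exact: differentiable_cst.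
have -> : 'D_v (cst c) = cst (0 : R) by apply/funext => y; exact: derive_cst.
exact: cvg_cst.
Qed.

Lemma C1_on_additive f : continuous f ->
  (forall (h : R) v x, f (h *: v + x) = h * f v + f x) -> C1_on [set: V] f.
Proof.
move=> cf lf.
have D x v : is_derive x v f (f v).
  apply: (@is_derive_quadratic _ _ _ _ _ _ 0) => h.
  by rewrite mulr0 addr0 lf addrC.
move=> x _; split=> [|v].
  have lf' : linear f by [].
  pose l : {linear V -> R} := HB.pack f (GRing.isLinear.Build _ _ _ _ f lf').
  exact: (@linear_differentiable _ _ _ l).
have -> : 'D_v f = cst (f v) by apply/funext => y; case: (D y v).
exact: cvg_cst.
Qed.

Lemma C1_onD f g : C1_on [set: V] f -> C1_on [set: V] g ->
  C1_on [set: V] (fun x => f x + g x).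
Proof.
move=> C1f C1g x _; split=> [|v].
  by apply: differentiableD; [exact: (C1f x I).1|exact: (C1g x I).1].
have -> : 'D_v (fun x => f x + g x) = (fun x => 'D_v f x + 'D_v g x).
  apply/funext => y; apply: (@deriveD _ _ _ f g);
    apply: diff_derivable; [exact: (C1f y I).1|exact: (C1g y I).1].
exact: (@continuousD _ _ _ _ _ x ((C1f x I).2 v) ((C1g x I).2 v)).
Qed.

Lemma C1_onM f g : C1_on [set: V] f -> C1_on [set: V] g ->
  C1_on [set: V] (fun x => f x * g x).
Proof.
move=> C1f C1g x _; split=> [|v].
  by apply: differentiableM; [exact: (C1f x I).1|exact: (C1g x I).1].
have -> : 'D_v (fun x => f x * g x) = (fun x => f x * 'D_v g x + g x * 'D_v f x).
  apply/funext => y; apply: (@deriveM _ _ f g);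
    apply: diff_derivable; [exact: (C1f y I).1|exact: (C1g y I).1].
have cf := differentiable_continuous (C1f x I).1.
have cg := differentiable_continuous (C1g x I).1.
exact: (continuousD (continuousM cf ((C1g x I).2 v)) (continuousM cg ((C1f x I).2 v))).
Qed.

Lemma C1_onX f N : C1_on [set: V] f -> C1_on [set: V] (fun x => f x ^+ N).
Proof.
move=> C1f; elim: N => [|N IH].
  have -> : (fun x => f x ^+ 0) = cst 1 by apply/funext => x; rewrite expr0.
  exact: C1_on_cst.
have -> : (fun x => f x ^+ N.+1) = (fun x => f x * f x ^+ N).
  by apply/funext => x; rewrite exprS.
exact: C1_onM.
Qed.

Lemma C1_on_sum (I : Type) (r : seq I) (F : I -> V -> R) :
  (forall i, C1_on [set: V] (F i)) -> C1_on [set: V] (fun x => \sum_(i <- r) F i x).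
Proof.
move=> C1F; elim: r => [|i r IH].
  have -> : (fun x => \sum_(i <- [::]) F i x) = cst 0.
    by apply/funext => x; rewrite big_nil.
  exact: C1_on_cst.
have -> : (fun x => \sum_(j <- i :: r) F j x) = (fun x => F i x + \sum_(j <- r) F j x).
  by apply/funext => x; rewrite big_cons.
exact: (C1_onD (C1F i) IH).
Qed.

Lemma C1_onT (U : set V) f : C1_on [set: V] f -> C1_on U f.
Proof. by move=> C1f x _; exact: C1f. Qed.

End C1.

Section C1Spacetime.
Variables (R : realType) (n : nat).
Let V := (R * 'rV[R]_n)%type.

Lemma C1_on_time : C1_on [set: V] (fun p : V => p.1).
Proof. by apply: C1_on_additive => // p; exact: cvg_fst. Qed.

Lemma C1_on_coord i : C1_on [set: V] (fun p : V => p.2 0 i).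
Proof.
apply: C1_on_additive => [p|h v x]; last by rewrite /= !mxE.
apply: (continuous_comp (g := fun v : 'rV[R]_n => v 0 i)); first exact: cvg_snd.
exact: coord_continuous.
Qed.

Lemma C1_on_dot (x : 'rV[R]_n) : C1_on [set: V] (fun p : V => dot x p.2).
Proof.
apply: C1_on_sum => i; apply: C1_onM; [exact: C1_on_cst | exact: C1_on_coord].
Qed.

Lemma C1_on_halfsq : C1_on [set: V] (fun p : V => halfsq p.2).
Proof.
apply: C1_onM; last exact: C1_on_cst.
by apply: C1_on_sum => i; apply: C1_onM; exact: C1_on_coord.
Qed.

Lemma C1_on_penalty (eta C : R) N :
  C1_on [set: V] (fun p : V => eta * p.1 + C * p.1 ^+ N.+1).
Proof.
apply: C1_onD; apply: C1_onM; first exact: C1_on_cst.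
- exact: C1_on_time.
- exact: C1_on_cst.
- by apply: C1_onX; exact: C1_on_time.
Qed.

Lemma is_derive_penalty (eta C t : R) N :
  is_derive t 1 (fun s => eta * s + C * s ^+ N.+1) (eta + C * (N.+1%:R * t ^+ N)).
Proof.
have d1 : is_derive t 1 (fun s => eta * s) eta.
  by apply: (@is_derive_quadratic _ _ _ _ _ _ 0) => h; rewrite [h *: _]mulr1; ring.
have d2 : is_derive t 1 (fun s => s ^+ N.+1) (N.+1%:R * t ^+ N).
  by split; [exact: exprn_derivable | rewrite exp_derive [LHS]mulr1].
exact: (is_deriveD d1 (is_deriveZ C d2)).
Qed.

End C1Spacetime.

(** * The Hopf formula *)

Section Attained.
Variables (R : realType) (n : nat).

(** The lower bound on [g] gives [dot x y - g x <= halfsq y + M - halfsq (x - y)]. Points with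
    [halfsq (x - y) > c] thus lose to [x0], and the others lie in a compact set. *)
Lemma legendre_on_attained (A : set 'rV[R]_n) M (g : 'rV[R]_n -> R) y :
  A !=set0 -> closed A -> (forall x, halfsq x - M <= g x) -> continuous g ->
  exists2 x, A x & legendre_on A g y = dot x y - g x.
Proof.
move=> [x0 Ax0] clA gM cg.
pose F x := dot x y - g x.
pose c := halfsq y + M - F x0.
pose K := [set x : 'rV[R]_n | `|x| <= `|y| + (1 + 2 * c)] `&` A.
have far x : halfsq (x - y) <= c \/ F x <= F x0.
  have [xc|xc] := leP (halfsq (x - y)) c; [by left|right].
  by have := gM x; rewrite halfsqB /c in xc; rewrite /F in xc *; lra.
have c0 : 0 <= c.
  by have := gM x0; have := halfsq_ge0 (x0 - y); rewrite halfsqB /c /F; lra.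
have inK x : A x -> halfsq (x - y) <= c -> K x.
  move=> Ax xc; split => //=; rewrite -(subrK y x) addrC.
  rewrite (le_trans (ler_normD _ _))// lerD2l.
  by apply: le_trans (norm_le_halfsq _) _; lra.
have cK : compact K by apply: compact_closedI => //; exact: compact_norm_le.
have [K0|K0] := pselect (K !=set0); last first.
  have [/(inK _ Ax0)|] := far x0; first by move=> ?; exfalso; apply: K0; exists x0.
  exists x0 => //; apply/eqP; rewrite eq_le (legendre_on_ge _ gM)//; last by exists x0.
  rewrite andbT; apply: (legendre_on_le _ gM); first by exists x0.
  move=> x Ax; have [/(inK _ Ax)?|//] := far x.
  by exfalso; apply: K0; exists x.
have cF : continuous F.
  have cd : continuous (fun x : 'rV[R]_n => dot x y).
    apply: (@continuous_dot R n _ id (cst y)); last exact: cst_continuous.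
    by move=> x; exact: cvg_id.
  by move=> x; exact: (continuousB (cd x) (cg x)).
have [|x1] := compact_EVT_max K0 cK (f := F); first exact: continuous_subspaceT.
rewrite inE => -[_ Ax1] mx.
have [x Ax xmax] : exists2 x, A x & forall z, A z -> F z <= F x.
  have [x10|x01] := leP (F x0) (F x1).
    exists x1 => // z Az; have [zc|zF] := far z; last exact: le_trans zF x10.
    by apply: mx; rewrite inE; exact: inK.
  exists x0 => // z Az; have [zc|//] := far z; apply: le_trans (ltW x01).
  by apply: mx; rewrite inE; exact: inK.
exists x => //; apply/eqP; rewrite eq_le (legendre_on_ge _ gM)//; last by exists x0.
by rewrite andbT; apply: (legendre_on_le _ gM) => //; exists x0.
Qed.

End Attained.

Section Hopf.
Variables (R : realType) (n : nat) (psi0 H : 'rV[R]_n -> R) (M hb : R).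
Hypotheses (cpsi0 : convex_fun psi0) (npsi0 : near_halfsq M psi0).
Hypotheses (cH : continuous H) (H0 : forall x, 0 <= H x) (Hb : forall x, H x <= hb).
Let phi0 := legendre psi0.

Definition hopf (t : R) : 'rV[R]_n -> R := legendre (fun x => phi0 x + t * H x).

Lemma hb_ge0 : 0 <= hb.
Proof. exact: le_trans (H0 0) (Hb 0). Qed.

Lemma hopf_arg_near t : near_halfsq (M + `|t| * hb) (fun x => phi0 x + t * H x).
Proof.
move=> x; have /andP[h1 h2] := legendre_near npsi0 x.
have : `|t * H x| <= `|t| * hb by rewrite normrM ler_wpM2l// ger0_norm.
by rewrite ler_norml => /andP[h3 h4]; apply/andP; rewrite /phi0; split; lra.
Qed.

Lemma hopf_ge t x y : dot x y - (phi0 x + t * H x) <= hopf t y.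
Proof. exact: legendre_ge (hopf_arg_near t). Qed.

Lemma hopf_le t y c : (forall x, dot x y - (phi0 x + t * H x) <= c) -> hopf t y <= c.
Proof. exact: legendre_le (hopf_arg_near t). Qed.

Lemma hopf0 : hopf 0 = psi0.
Proof.
rewrite -[RHS](biconjugate cpsi0 npsi0) /hopf; congr legendre.
by apply/funext => x; rewrite mul0r addr0.
Qed.

Lemma phi0_continuous : continuous phi0.
Proof. exact: legendre_continuous npsi0. Qed.

Lemma hopf_attained t y : exists x, hopf t y = dot x y - (phi0 x + t * H x).
Proof.
have [||||x _ E] := @legendre_on_attained R n setT (M + `|t| * hb)
  (fun x => phi0 x + t * H x) y.
- by exists 0.
- exact: closedT.
- by move=> x; case/andP: (hopf_arg_near t x).
- have c' := continuous_mulf (@cst_continuous _ _ t) cH.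
  by move=> x; exact: (continuousD (@phi0_continuous x) (c' x)).
by exists x.
Qed.

Lemma hopf_lipschitz_time s t y : hopf t y <= hopf s y + `|t - s| * hb.
Proof.
apply: hopf_le => x; have := hopf_ge s x y.
have : `|(t - s) * H x| <= `|t - s| * hb by rewrite normrM ler_wpM2l// ger0_norm.
by rewrite ler_norml => /andP[h3 h4]; lra.
Qed.

Lemma hopf_near t : near_halfsq (M + `|t| * hb) (hopf t).
Proof. exact: legendre_near (hopf_arg_near t). Qed.

Lemma hopf_convex t : convex_fun (hopf t).
Proof. exact: legendre_convex (hopf_arg_near t). Qed.

Lemma hopf_continuous : continuous (fun p : R * 'rV[R]_n => hopf p.1 p.2).
Proof.
move=> [t y]; apply/cvgrPdist_lt => e e0 /=.
have e2 : 0 < e / 2 by rewrite divr_gt0.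
have h1 : 0 < hb + 1 by have := hb_ge0; lra.
have ct := convex_near_continuous (hopf_convex t) (hopf_near t) (x := y).
have c2 : {for (t, y), continuous (hopf t \o @snd R 'rV[R]_n)}.
  by apply: (@continuous_comp _ _ _ (@snd R _) (hopf t)); [exact: cvg_snd|exact: ct].
have c1 : {for (t, y), continuous (@fst R 'rV[R]_n)} by exact: cvg_fst.
have eh : 0 < e / 2 / (hb + 1) by rewrite divr_gt0.
near=> p; have : `|hopf t y - hopf t p.2| < e / 2.
  by near: p; move/cvgrPdist_lt : c2; apply.
have : `|t - p.1| <= e / 2 / (hb + 1).
  by near: p; move/cvgrPdist_le : c1; apply.
rewrite ler_pdivlMr// => h2 h3.
have h4 := hopf_lipschitz_time t p.1 p.2; have h5 := hopf_lipschitz_time p.1 t p.2.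
have h6 := normr_ge0 (t - p.1); have h7 := hb_ge0.
have h8 : `|t - p.1| * hb <= e / 2 by nra.
rewrite (distrC p.1 t) in h4.
move: h3; rewrite !ltr_norml => /andP[h31 h32]; apply/andP; split; lra.
Unshelve. all: by end_near. Qed.

(** The segment runs from [(t, y)] at [h = 0] to [(0, y + w)] at [h = 1]; each competitor in the
    supremum is affine along it. *)
Lemma hopf_line t y w (h : R) : 0 <= h <= 1 ->
  hopf (t - h * t) (y + h *: w) <= (1 - h) * hopf t y + h * psi0 (y + w).
Proof.
move=> /andP[h0 h1]; apply: hopf_le => x; rewrite -hopf0.
have e1 := hopf_ge t x y; have e2 := hopf_ge 0 x (y + w).
have e3 : (1 - h) * (dot x y - (phi0 x + t * H x)) <= (1 - h) * hopf t y.
  by rewrite ler_wpM2l// subr_ge0.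
have e4 : h * (dot x (y + w) - (phi0 x + 0 * H x)) <= h * hopf 0 (y + w).
  by rewrite ler_wpM2l.
apply: le_trans (lerD e3 e4); rewrite !dotE; lra.
Qed.

(* By joint convexity a touching from below propagates to all of space-time,
   and its value at time 0 compares the Legendre transforms at the point p. *)
Lemma hopf_super_line t y (a : R) p : 0 < t ->
  (forall w, exists (k : R -> R) (d : R),
    [/\ is_derive (0 : R) 1 k (dot p w - a * t), 0 < d &
      forall h, 0 < h < d ->
        k h - k 0 <= hopf (t - h * t) (y + h *: w) - hopf t y]) ->
  0 <= a + H p.
Proof.
move=> t0 touch.
have slope w : dot p w - a * t <= psi0 (y + w) - hopf t y.
  have [k [d [dk d0 kP]]] := touch w.
  have d1 : 0 < Num.min d 1 by rewrite lt_min d0 ltr01.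
  apply: (derive_le_right d1 dk) => h /andP[h0]; rewrite lt_min => /andP[hd h1].
  have hd' : 0 < h < d by rewrite h0.
  have h01 : 0 <= h <= 1 by rewrite !ltW.
  apply: le_trans (kP h hd') _.
  by have := hopf_line t y w h01; lra.
(* The slopes for all [w] say that every [dot p z - psi0 z] is below the right-hand side, hence so
   is their supremum [phi0 p]. The Hopf formula with competitor [p] bounds [phi0 p] from below, and
   the difference is [t * (a + H p)]. *)
have : phi0 p <= dot p y + a * t - hopf t y.
  apply: (legendre_le npsi0) => z; have := slope (z - y).
  by rewrite (addrC y) subrK !dotE (dotC z p); lra.
have := hopf_ge t p y; rewrite -(pmulr_rge0 _ t0); lra.
Qed.

Lemma hopf_viscosity_supersolution : viscosity_supersolution H hopf.
Proof.
move=> f t y C1f t0 touch; apply: (@hopf_super_line t y) => // w.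
exists (fun h => f (h *: (- t, w) + (t, y))).
have [d d0 dP] := near_line (- t, w) touch; exists d; split => //.
  apply: (is_derive_lineP f (t, y) (- t, w) _).1.
  have df := (C1f (t, y) t0).1.
  have := derivableP (diff_derivable (v := (- t, w)) df).
  by rewrite (derive_time_grad _ _ df) mulNr addrC (mulrC t).
move=> h /andP[h0 hd]; rewrite scale0r add0r.
have {}dP := dP h; rewrite gtr0_norm// in dP; have := dP hd.
rewrite /spacetime /= (_ : h *: (- t) + t = t - h * t); last first.
  by rewrite [_ *: _]mulrN addrC.
have -> : h *: w + y = y + h *: w by rewrite addrC.
rewrite (_ : h *: (- t, w) + (t, y) = (t - h * t, y + h *: w)); last first.
  by rewrite -mulrN (addrC y) (addrC t).
by lra.
Qed.

(* A maximizer [x] in the Hopf formula gives a smooth solution, affine in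
   space-time, touching [hopf] from below. *)
Lemma hopf_viscosity_subsolution : viscosity_subsolution H hopf.
Proof.
move=> f t y C1f t0 touch; have [x xE] := hopf_attained t y.
have df := (C1f (t, y) t0).1.
(* [hopf - f] has a local maximum and the affine function of the maximizer [x] lies below [hopf],
   with equality at [(t, y)]. So [f] minus this affine function has a local minimum there, which
   fixes all directional derivatives of [f]. *)
have crit (tau : R) w : 'D_(tau, w) f (t, y) = dot x w - tau * H x.
  have [d d0 dP] := near_line (tau, w) touch.
  pose k h := f (h *: (tau, w) + (t, y)) - h * (dot x w - tau * H x).
  apply/eqP; rewrite -subr_eq0; apply/eqP.
  apply: (@derive_eq0_at_min _ k _ d) => //.
    apply: is_deriveB.
      apply: (is_derive_lineP f (t, y) (tau, w) _).1.
      exact/derivableP/diff_derivable.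
    apply: (@is_derive_quadratic _ _ _ _ _ _ 0) => h.
    by rewrite [h *: _]mulr1; ring.
  move=> h /dP; rewrite /spacetime /k scale0r add0r mul0r subr0 xE /=.
  by have := hopf_ge (h * tau + t) x (h *: w + y); rewrite !dotE; lra.
have dt : derive1 (fun s => f (s, y)) t = - H x.
  have := derive_time_grad 1 0 df; rewrite crit !dotE; lra.
have dx : grad (fun z => f (t, z)) y = x.
  apply/rowP => i; rewrite -[LHS]dot_delta -[RHS]dot_delta.
  have := derive_time_grad 0 (delta_mx 0 i) df; rewrite crit; lra.
by rewrite /hamilton_jacobi dt dx addNr.
Qed.

End Hopf.

(** * Comparison of viscosity solutions *)

Section Spacetime.
Variables (R : realType) (n : nat).

(** Freezing [u] at its initial value for negative times turns continuity up to time 0 into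
    continuity everywhere, as the compactness lemmas require. *)
Lemma continuous_clamp (u : R -> 'rV[R]_n -> R) :
  {within @nonneg_times R n, continuous (spacetime u)} ->
  continuous (fun p : R * 'rV[R]_n => u (Num.max 0 p.1) p.2).
Proof.
move=> /subspace_continuousP cu p.
pose g (p : R * 'rV[R]_n) := (Num.max 0 p.1, p.2).
have gA q : nonneg_times (g q) by rewrite /nonneg_times /= le_max lexx.
have c1 : {for p, continuous (fun q : R * 'rV[R]_n => Num.max 0 q.1)}.
  by apply: (@continuous_max R _ (cst 0) fst); [exact: cst_continuous|exact: cvg_fst].
have c2 : {for p, continuous (@snd R 'rV[R]_n)} by exact: cvg_snd.
have cg : {for p, continuous g} by exact: cvg_pair c1 c2.
move=> W hW; apply: (@filterS _ _ (nbhs_filter p) _ _ _ (cg _ (cu _ (gA p) W hW))).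
by move=> q /(_ (gA q)).
Qed.

Lemma near_time_itv (t T : R) (y : 'rV[R]_n) : 0 < t < T ->
  \forall p \near (t, y), 0 < p.1 < T.
Proof.
move=> /andP[t0 tT].
have c : p.1 @[p --> (t, y)] --> t by exact: cvg_fst.
near=> p; apply/andP; split; near: p.
  exact: (cvgr_gt t c 0 t0).
exact: (cvgr_lt t c T tT).
Unshelve. all: by end_near. Qed.

End Spacetime.

Section Uniqueness.
Variables (R : realType) (n : nat) (L : set 'rV[R]_n).
Variables (psi0 H : 'rV[R]_n -> R) (M hb : R).
Hypotheses (HL : unimodular_lattice L) (CLpsi0 : CL L psi0).
Hypotheses (npsi0 : near_halfsq M psi0) (cH : continuous H) (pH : periodic L H).
Hypotheses (H0 : forall x, 0 <= H x) (Hb : forall x, H x <= hb).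
Let phi0 := legendre psi0.
Let psi := hopf psi0 H.
Let cpsi0 := CLpsi0.1.

Lemma phi0_CL : CL L phi0.
Proof.
split; first exact: legendre_convex npsi0.
apply: (@periodic_legendre_on _ _ _ HL setT M) => //; first by exists 0.
- by move=> x; case/andP: (npsi0 x).
- exact: CLpsi0.2.
Qed.

Lemma hopf_CL t : CL L (psi t).
Proof.
split; first exact: (hopf_convex npsi0 H0 Hb).
apply: (@periodic_legendre_on _ _ _ HL setT (M + `|t| * hb)) => //.
- by exists 0.
- by move=> x; case/andP: (hopf_arg_near npsi0 H0 Hb t x).
- move=> x l Ll; have := phi0_CL.2 x l Ll; rewrite -/phi0 pH//; lra.
Qed.

(** For the lower bound, a lattice translate of a point of [A] within distance [D] of [y] is the
    competitor. *)
Lemma legendre_on_near (A : set 'rV[R]_n) : A !=set0 ->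
  (forall x l, L l -> A x -> A (x + l)) ->
  exists M1, near_halfsq M1 (legendre_on A phi0).
Proof.
move=> [x0 Ax0] AL; have [D D0 DP] := lattice_covering HL.
have nphi0 := legendre_near npsi0.
have lo x : halfsq x - M <= phi0 x by case/andP: (nphi0 x).
have M0 : 0 <= M by have := nphi0 0; rewrite halfsq0; lra.
exists (M + n%:R * (D * D)) => y.
have D2 : 0 <= n%:R * (D * D) by rewrite !mulr_ge0// ltW.
apply/andP; split; last first.
  apply: le_trans (legendre_on_le_halfsq _ lo y) _; [by exists x0 | lra].
have [l Ll xl] := DP (x0 - y).
apply: le_trans (legendre_on_ge _ lo y (AL _ _ Ll Ax0)); last by exists x0.
have /andP[_ h1] := nphi0 (x0 + l); rewrite -/phi0 in h1.
have h2 : halfsq ((x0 + l) - y) <= n%:R * (D * D).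
  rewrite addrAC; have := dot_ge0 (x0 - y + l); rewrite /halfsq => h.
  have : dot (x0 - y + l) (x0 - y + l) <= n%:R * (D * D).
    apply: le_trans (ler_norm _) _; apply: le_trans (norm_dot_le _ _) _.
    by rewrite ler_wpM2l// ler_pM.
  lra.
by rewrite halfsqB in h2; lra.
Qed.

Lemma hopf_ge_legendre_on (A : set 'rV[R]_n) t y : A !=set0 ->
  (forall x, A x -> H x = 0) -> legendre_on A phi0 y <= psi t y.
Proof.
move=> A0 AH; apply: (@legendre_on_le _ _ A M) => //.
  by move=> x; case/andP: (legendre_near npsi0 x).
move=> x Ax; apply: le_trans (hopf_ge npsi0 H0 Hb t x y).
by rewrite AH// mulr0 addr0.
Qed.

Lemma hopf_le_initial t y : 0 <= t -> psi t y <= psi0 y.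
Proof.
move=> t0; apply: (hopf_le npsi0 H0 Hb) => x.
have := hopf_ge npsi0 H0 Hb 0 x y; rewrite (hopf0 H cpsi0 npsi0) -/phi0.
by have := mulr_ge0 t0 (H0 x); lra.
Qed.

(** The constant no longer depends on time: the Hopf solution stays between [legendre_on A phi0] and
    the initial datum. *)
Lemma hopf_near_unif (A : set 'rV[R]_n) : A !=set0 ->
  (forall x l, L l -> A x -> A (x + l)) -> (forall x, A x -> H x = 0) ->
  exists M1, forall t, 0 <= t -> near_halfsq M1 (psi t).
Proof.
move=> A0 AL AH; have [M1 M1P] := legendre_on_near A0 AL.
exists (`|M1| + `|M|) => t t0 y.
have := hopf_le_initial y t0; have := hopf_ge_legendre_on t y A0 AH.
have := M1P y; have := npsi0 y; have := ler_norm M; have := ler_norm M1.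
have := normr_ge0 M; have := normr_ge0 M1.
by move=> h1 h2 h3 h4 /andP[h5 h6] /andP[h7 h8] h9 h10; apply/andP; split; lra.
Qed.

Variable v : R -> 'rV[R]_n -> R.
Hypotheses (vCL : forall t, 0 <= t -> CL L (v t)).
Hypothesis vcont : {within @nonneg_times R n, continuous (spacetime v)}.
Hypothesis v0 : v 0 = psi0.

Let v' t := v (Num.max 0 t).
Let cv' : continuous (fun p : R * 'rV[R]_n => v' p.1 p.2) := continuous_clamp vcont.

Let v'E t : 0 <= t -> v' t = v t.
Proof. by move=> t0; rewrite /v' max_r. Qed.

Lemma CL_time_near T : exists B, forall t, 0 <= t <= T -> near_halfsq B (v t).
Proof.
pose a t y := v' t y - halfsq y.
have ca : continuous (fun p : R * 'rV[R]_n => a p.1 p.2).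
  by apply: continuous_subf => //; apply: continuous_halfsq; exact: continuous_snd.
have [|B BP] := @periodic_bounded _ _ _ HL a T ca.
  move=> t /andP[t0 _] y l Ll; rewrite /a v'E//.
  by have := (vCL t0).2 y l Ll.
exists B => t tT y; have := BP t y tT; rewrite /a v'E; last by case/andP: tT.
by rewrite ler_norml => /andP[h1 h2]; apply/andP; split; lra.
Qed.

(* Each affine function in the Hopf formula is a classical solution lying below
   the initial datum. *)
Lemma supersolution_ge_hopf : viscosity_supersolution H v ->
  forall t y, 0 <= t -> psi t y <= v t y.
Proof.
move=> vsup t1 y1 t1_ge0.
have [t1E|t1N] := eqVneq t1 0.
  by rewrite t1E v0 /psi (hopf0 H cpsi0 npsi0).
have {t1_ge0} t10 : 0 < t1 by rewrite lt_neqAle eq_sym t1N.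
apply: (hopf_le npsi0 H0 Hb) => x; rewrite -/phi0.
pose T := 2 * t1; have [B BP] := CL_time_near T.
pose F t y := dot x y - (phi0 x + t * H x) - v' t y.
(* Outside [K], [halfsq (x - y)] exceeds twice the absolute value of [B], and then [F t y] is below
   [F t x]. *)
pose K := [set y : 'rV[R]_n | `|y| <= `|x| + (1 + 4 * `|B|)].
suff main eta : 0 < eta -> F t1 y1 <= 0 + eta * t1.
  have : F t1 y1 <= 0.
    apply/ler_addgt0Pl => e e0; have := main (e / t1) (divr_gt0 e0 t10).
    by rewrite divfK ?gt_eqF// add0r addr0.
  by rewrite /F (v'E (ltW t10)) => ?; lra.
move=> eta0; apply: (@time_max _ _ F K 0 eta t1) => //.
- exact: compact_norm_le.
- by exists 0; rewrite /K /= normr0 addr_ge0//; have := normr_ge0 B; lra.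
- apply: continuous_subf => //; apply: continuous_subf.
    apply: (@continuous_dot _ _ _ (cst x) snd); first exact: cst_continuous.
    exact: continuous_snd.
  apply: continuous_addf; first exact: cst_continuous.
  by apply: continuous_mulf; [exact: continuous_fst|exact: cst_continuous].
- move=> t y tT; have t0 : 0 <= t by case/andP: tT.
  have [yK|yK] := leP `|y| (`|x| + (1 + 4 * `|B|)); first by exists y.
  exists x; first by rewrite /K /= lerDl; have := normr_ge0 B; lra.
  have := BP t tT x; have := BP t tT y; rewrite /F v'E// => /andP[h1 h2] /andP[h3 h4].
  have h5 := norm_le_halfsq (x - y); have h6 := ler_normD x (y - x).
  have h7 := ler_norm B; rewrite [X in `|X|]addrC subrK distrC in h6.
  by rewrite halfsqB in h5; rewrite /halfsq in h1 h2 h3 h4 h5 *; lra.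
- move=> y; rewrite /F v'E// v0 mul0r addr0.
  have := legendre_ge y x npsi0; rewrite dotC -/phi0; lra.
move=> C N t0 y0 C0 t0T _ mx; have t0p : 0 < t0 by case/andP: t0T.
pose f (p : R * 'rV[R]_n) :=
  dot x p.2 + ((- H x - eta) * p.1 + (- C) * p.1 ^+ N.+1).
have C1f : C1_on [set: R * 'rV[R]_n] f.
  by apply: C1_onD; [exact: C1_on_dot | exact: C1_on_penalty].
have := vsup f t0 y0 (C1_onT C1f) t0p _.
rewrite /hamilton_jacobi.
have -> : grad (fun z => f (t0, z)) y0 = x.
  apply: (@grad_quadratic _ _ _ _ _ (fun=> 0)) => h w.
  by rewrite /f /= !dotE; ring.
have -> : derive1 (fun s => f (s, y0)) t0 =
    (- H x - eta) + (- C) * (N.+1%:R * t0 ^+ N).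
  rewrite derive1E -[RHS]add0r.
  by have [_ ->] := is_deriveD (is_derive_cst (dot x y0) t0 1)
    (is_derive_penalty (- H x - eta) (- C) t0 N).
move=> contra; have : 0 <= - H x - eta + - C * (N.+1%:R * t0 ^+ N) + H x.
  apply: contra; have := near_time_itv y0 t0T; apply: filterS => -[t y] /= /andP[t_gt0 tT].
  have t01 : 0 <= t <= 2 * t1 by rewrite !ltW.
  have := mx t y t01; rewrite /spacetime /f /F /= (v'E (ltW t_gt0)) (v'E (ltW t0p)).
  lra.
have : 0 <= C * (N.+1%:R * t0 ^+ N) by rewrite mulr_ge0// mulr_ge0// exprn_ge0// ltW.
rewrite mulNr; lra.
Qed.

(* Doubling of variables. A maximum at time 0 of the doubled variable [s] is
   excluded by uniform continuity, since both functions start from [psi0]. *)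
Lemma subsolution_le_hopf (A : set 'rV[R]_n) : A !=set0 ->
  (forall x l, L l -> A x -> A (x + l)) -> (forall x, A x -> H x = 0) ->
  viscosity_subsolution H v -> forall t y, 0 <= t -> v t y <= psi t y.
Proof.
move=> A0 AL AH vsub t1 y1 t1_ge0.
have [t1E|t1N] := eqVneq t1 0.
  by rewrite t1E v0 /psi (hopf0 H cpsi0 npsi0).
have {t1_ge0} t10 : 0 < t1 by rewrite lt_neqAle eq_sym t1N.
pose T := 2 * t1; have T0 : 0 < T by rewrite mulr_gt0.
pose psi' s := psi (Num.max 0 s).
have psi'E s : 0 <= s -> psi' s = psi s by move=> s0; rewrite /psi' max_r.
have max0 (s : R) : 0 <= Num.max 0 s by rewrite le_max lexx.
(* The periodic parts are bounded and uniformly continuous, whereas [v] and [psi] themselves grow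
   quadratically. *)
pose a t y := v' t y - halfsq y.
pose b s z := psi' s z - halfsq z.
have chs : continuous (fun p : R * 'rV[R]_n => halfsq p.2).
  by apply: continuous_halfsq; exact: continuous_snd.
have ca : continuous (fun p : R * 'rV[R]_n => a p.1 p.2) by exact: continuous_subf.
have cpsi' : continuous (fun p : R * 'rV[R]_n => psi' p.1 p.2).
  apply: (@continuous_clamp _ _ psi); apply: continuous_subspaceT.
  exact: (hopf_continuous npsi0 H0 Hb).
have cb : continuous (fun p : R * 'rV[R]_n => b p.1 p.2) by exact: continuous_subf.
have pa t : periodic L (a t) by move=> y l Ll; exact: (vCL (max0 t)).2.
have pb s : periodic L (b s) by move=> y l Ll; exact: (hopf_CL _).2.
have [B1 B1P] := CL_time_near T; have [B2 B2P] := hopf_near_unif A0 AL AH.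
pose B := `|B1| + `|B2| + 1.
have B0 : 0 < B by rewrite ltr_wpDl// addr_ge0.
have aB t y : 0 <= t <= T -> - B <= a t y <= B.
  move=> tT; have := B1P t tT y; rewrite /a v'E; last by case/andP: tT.
  have := ler_norm B1; have := normr_ge0 B2 => h1 h2 /andP[h3 h4].
  by apply/andP; rewrite /B; split; lra.
have bB s z : - B <= b s z <= B.
  have := B2P _ (max0 s) z; rewrite /b.
  have := ler_norm B2; have := normr_ge0 B1 => h1 h2 /andP[h3 h4].
  by apply/andP; rewrite /B /psi'; split; lra.
suff main kap eta : 0 < kap -> 0 < eta -> v t1 y1 - psi t1 y1 <= kap + eta * t1.
  rewrite -subr_le0; apply/ler_addgt0Pl => e e0; rewrite addr0.
  have e2 : 0 < e / 2 by rewrite divr_gt0.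
  have := main (e / 2) (e / 2 / t1) e2 (divr_gt0 e2 t10).
  by rewrite divfK ?gt_eqF// -splitr.
move=> kap0 eta0; have eta2 : 0 < eta / 2 by rewrite divr_gt0.
have [da da0 daP] := periodic_uniform HL ca (T := T) (fun t _ => pa t) kap0.
have [db db0 dbP] := periodic_uniform HL cb (T := T) (fun t _ => pb t) kap0.
have [dh dh0 dhP] := periodic_uniform1 HL cH pH eta2.
have [d [d0 dda ddb ddh dT]] : exists d, [/\ 0 < d, d <= da, d <= db, d <= dh & d <= T].
  exists (Num.min (Num.min da db) (Num.min dh T)).
  by rewrite !lt_min !ge_min !lexx !orbT da0 db0 dh0 T0.
(* The difference of the periodic parts is at most [2 * B]. With this [k], a positive value of [F]
   forces both the times and the points to be within [d] of each other. *)
pose k := 4 * B / d ^+ 2.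
have k0 : 0 < k by rewrite divr_gt0 ?exprn_gt0// mulr_gt0.
have kd : k * (d ^+ 2 / 2) = 2 * B.
  by rewrite /k; field; rewrite gt_eqF.
pose pen (t s : R) (w : 'rV[R]_n) := halfsq w + (t - s) ^+ 2 / 2.
pose F t (e : R * ('rV[R]_n * 'rV[R]_n)) :=
  a t e.2.1 - b e.1 e.2.2 - k * pen t e.1 (e.2.1 - e.2.2).
have close t s w : k * pen t s w <= 2 * B -> `|w| <= d /\ `|t - s| <= d.
  rewrite -kd ler_pM2l// /pen => h; have h1 := halfsq_ge0 w.
  have h2 := sqr_ge0 (t - s); split.
    by apply: norm_le_of_halfsq => //; lra.
  rewrite -(@ler_pXn2r _ 2)// ?nnegrE//; last exact: ltW.
  by rewrite real_normK ?num_real//; lra.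
have small t s y z : `|y - z| <= d -> `|t - s| <= d -> 0 <= t <= T -> 0 <= s <= T ->
    a t y - a s z <= kap /\ b t y - b s z <= kap.
  move=> yz ts tT sT; split; apply: le_trans (ler_norm _) _.
  - by apply: daP => //; [apply: le_trans ts _|apply: le_trans yz _].
  - by apply: dbP => //; [apply: le_trans ts _|apply: le_trans yz _].
have T00 : 0 <= (0 : R) <= T by rewrite lexx ltW.
have ab0 y : a 0 y = b 0 y by rewrite /a /b v'E// psi'E// v0 /psi (hopf0 H cpsi0 npsi0).
have Fpos t e : 0 <= t <= T -> 0 < F t e -> `|e.2.1 - e.2.2| <= d /\ `|t - e.1| <= d.
  move=> tT; rewrite /F => Fp; apply: close.
  by move/andP: (aB t e.2.1 tT) => [_ h1]; move/andP: (bB e.1 e.2.2) => [h2 _]; lra.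
have k_pen t s w : 0 <= k * pen t s w.
  apply: mulr_ge0; first exact: ltW.
  by rewrite /pen addr_ge0 ?halfsq_ge0// divr_ge0// sqr_ge0.
have F0le e : F 0 e <= kap.
  have [Fn|Fp] := leP (F 0 e) 0; first by rewrite (le_trans Fn)// ltW.
  have [yz ts] := Fpos _ _ T00 Fp.
  have sT : 0 <= Num.max 0 e.1 <= T.
    rewrite max0 /= ge_max (ltW T0) /=; apply: le_trans dT; apply: le_trans ts.
    by rewrite sub0r normrN ler_norm.
  have ts' : `|0 - Num.max 0 e.1| <= d.
    by rewrite maxEle; case: ifP => // _; rewrite subr0 normr0 ltW.
  have bE : b e.1 = b (Num.max 0 e.1) by rewrite /b /psi' (max_r (max0 _)).
  have [_ h] := small _ _ _ _ yz ts' T00 sT.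
  have := k_pen 0 e.1 (e.2.1 - e.2.2); rewrite /F ab0 bE; lra.
suff : F t1 (t1, (y1, y1)) <= kap + eta * t1.
  rewrite /F /= /pen !subrr halfsq0 /a /b v'E ?psi'E; try exact: ltW.
  by rewrite expr0n/= mul0r addr0 mulr0; lra.
have [D D0 DP] := lattice_covering HL.
(* Where [F] is below [- (2 * B)], the diagonal point [(t, (0, 0))] does better. Elsewhere [pen] is
   at most [4 * B / k], which keeps [y - z] and [t - s] within [S]; a common lattice translation of
   [y] and [z] does the rest. *)
pose S := 1 + 8 * B / k; have u0 : 0 < 8 * B / k by rewrite divr_gt0// mulr_gt0.
have S0 : 0 < S by rewrite addr_gt0.
pose K := `[- S, T + S]%classic `*`
  ([set y : 'rV[R]_n | `|y| <= D + S] `*` [set y : 'rV[R]_n | `|y| <= D + S]).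
have inK s y z : - S <= s <= T + S -> `|y| <= D + S -> `|z| <= D + S -> K (s, (y, z)).
  by move=> sS yD zD; split => //=; rewrite in_itv.
have DS : 0 <= D + S by rewrite addr_ge0// ltW.
apply: (@time_max _ _ F K kap eta t1) => //.
- apply: compact_setX; first exact: segment_compact.
  by apply: compact_setX; exact: compact_norm_le.
- exists (0, (0, 0)); apply: inK; rewrite ?normr0//.
  by apply/andP; split; lra.
- have cs : continuous (fun p : R * (R * ('rV[R]_n * 'rV[R]_n)) => p.2.1).
    by apply: continuous_compf; [exact: continuous_fst|exact: continuous_snd].
  have cy : continuous (fun p : R * (R * ('rV[R]_n * 'rV[R]_n)) => p.2.2.1).
    apply: (continuous_compf (f := fst)); first exact: continuous_fst.
    by apply: (continuous_compf (f := snd)); exact: continuous_snd.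
  have cz : continuous (fun p : R * (R * ('rV[R]_n * 'rV[R]_n)) => p.2.2.2).
    apply: (continuous_compf (f := snd)); first exact: continuous_snd.
    by apply: (continuous_compf (f := snd)); exact: continuous_snd.
  have ct : continuous (fun p : R * (R * ('rV[R]_n * 'rV[R]_n)) => p.1).
    exact: continuous_fst.
  rewrite /F /pen; apply: continuous_subf; first apply: continuous_subf.
  + exact: (continuous_compf ca (continuous_pair ct cy)).
  + exact: (continuous_compf cb (continuous_pair cs cz)).
  + apply: continuous_mulf; first exact: cst_continuous.
    apply: continuous_addf.
      apply: continuous_halfsq => p; apply: cvgB; [exact: cy|exact: cz].
    by apply: continuous_mulf; [apply: continuous_mulf; exact: continuous_subf|exact: cst_continuous].
- move=> t [s [y z]] tT; have [t0 tT'] := andP tT; rewrite -/T in tT'.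
  have [Fl|Fl] := leP (- (2 * B)) (F t (s, (y, z))); last first.
    exists (t, (0, 0)); first by apply: inK; rewrite ?normr0//; apply/andP; split; lra.
    apply: le_trans (ltW Fl) _; rewrite /F /pen /= !subrr halfsq0.
    move/andP: (aB t 0 tT) => [h1 _]; move/andP: (bB t 0) => [_ h2].
    by rewrite expr0n/= mul0r addr0 mulr0; lra.
  have penle : pen t s (y - z) <= 4 * B / k.
    rewrite ler_pdivlMr// mulrC; move: Fl; rewrite /F /=.
    by move/andP: (aB t y tT) => [_ h1]; move/andP: (bB s z) => [h2 _]; lra.
  have yzS : `|y - z| <= S.
    apply: le_trans (norm_le_halfsq _) _; have := sqr_ge0 (t - s).
    by rewrite /pen in penle; rewrite /S; lra.
  have tsS : `|t - s| <= S.
    rewrite -(@ler_pXn2r _ 2)// ?nnegrE//; last exact: ltW.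
    rewrite real_normK ?num_real//; have := halfsq_ge0 (y - z).
    by rewrite /pen in penle; rewrite /S; nra.
  have [l Ll yl] := DP y.
  exists (s, (y + l, z + l)); last first.
    have e : y + l - (z + l) = y - z by rewrite opprD addrACA subrr addr0.
    have pa' := pa t y l Ll; have pb' := pb s z l Ll.
    by rewrite /F /= e pa' pb'.
  apply: inK.
  + by move: tsS; rewrite ler_norml => /andP[h1 h2]; apply/andP; split; lra.
  + by rewrite (le_trans yl)// lerDl ltW.
  + have -> : z + l = (y + l) + (z - y) by apply/rowP => i; rewrite !mxE; ring.
    by rewrite (le_trans (ler_normD _ _))// lerD// distrC.
move=> C N t0 [s0 [y0 z0]] C0 t0T Fgt mx; have [t0p t0T'] := andP t0T.
pose g t := eta * t + C * t ^+ N.+1.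
have g0 t : 0 <= t -> 0 <= g t.
  by move=> tge; rewrite /g addr_ge0// mulr_ge0// ?exprn_ge0// ltW.
have t01 : 0 <= t0 <= T by rewrite !ltW.
have Fgt' : kap < F t0 (s0, (y0, z0)).
  by have := g0 t0 (ltW t0p); rewrite /g; lra.
have [/= yz ts] := Fpos t0 (s0, (y0, z0)) t01 (lt_trans kap0 Fgt').
have [s0n|s0p] := leP s0 0.
  have ts' : `|t0 - 0| <= d.
    apply: le_trans ts; rewrite subr0 !ger0_norm; try lra; exact: ltW.
  have [h _] := small _ _ _ _ yz ts' t01 T00.
  have := k_pen t0 s0 (y0 - z0).
  have bE : b s0 = b 0 by rewrite /b /psi' (max_l s0n) maxxx.
  by move: Fgt'; rewrite /F /= bE -ab0; lra.
(* Doubling the periodic parts shifts the slopes by [y0] and [z0], so [H] is evaluated at the two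
   points [y0 + P] and [z0 + P]. They are within [d], and uniform continuity of [H] leaves an error
   of at most [eta / 2], less than the slope of the penalty. *)
pose P := k *: (y0 - z0).
pose f (p : R * 'rV[R]_n) := (1 + k) * halfsq p.2 + dot (- k *: z0) p.2 +
  (k / 2 * (p.1 + - s0) ^+ 2 + (eta * p.1 + C * p.1 ^+ N.+1)).
have C1f : C1_on [set: R * 'rV[R]_n] f.
  apply: C1_onD; first apply: C1_onD.
  - by apply: C1_onM; [exact: C1_on_cst|exact: C1_on_halfsq].
  - exact: C1_on_dot.
  - apply: C1_onD; last exact: C1_on_penalty.
    apply: C1_onM; first exact: C1_on_cst.
    by apply: C1_onX; apply: C1_onD; [exact: C1_on_time|exact: C1_on_cst].
pose dg := eta + C * (N.+1%:R * t0 ^+ N).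
have dg_ge : eta <= dg.
  by rewrite lerDl mulr_ge0// mulr_ge0// exprn_ge0// ltW.
have sub : k * (t0 - s0) + dg + H (y0 + P) <= 0.
  have := vsub f t0 y0 (C1_onT C1f) t0p _; rewrite /hamilton_jacobi.
  have -> : grad (fun z => f (t0, z)) y0 = y0 + P.
    apply: (@grad_quadratic _ _ _ _ _ (fun w => (1 + k) * halfsq w)) => h w.
    by rewrite /f /P /= !halfsqD !halfsqZ !dotE (dotC w y0); ring.
  have -> : derive1 (fun s => f (s, y0)) t0 = k * (t0 - s0) + dg.
    have dq : is_derive t0 1 (fun s => k / 2 * (s + - s0) ^+ 2) (k * (t0 - s0)).
      apply: (@is_derive_quadratic _ _ _ _ _ _ (k / 2)) => h.
      by rewrite [h *: _]mulr1; field.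
    rewrite derive1E -[RHS]add0r.
    by have [_ ->] := is_deriveD
      (is_derive_cst ((1 + k) * halfsq y0 + dot (- k *: z0) y0) t0 1)
      (is_deriveD dq (is_derive_penalty eta C t0 N)).
  apply; have := near_time_itv y0 t0T; apply: filterS => -[t y] /= /andP[t_gt0 tT].
  have tle : 0 <= t <= 2 * t1 by rewrite !ltW.
  have := mx t (s0, (y, z0)) tle; rewrite /spacetime /f /F /pen /a /=.
  rewrite (v'E (ltW t_gt0)) (v'E (ltW t0p)) !halfsqB !dotE (dotC z0 y) (dotC z0 y0).
  lra.
have sup : 0 <= k * (t0 - s0) + H (z0 + P).
  apply: (@hopf_super_line _ _ psi0 H M hb cpsi0 npsi0 H0 Hb s0 z0) => // w.
  pose A1 := dot (z0 + P) w - k * (t0 - s0) * s0.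
  pose A2 := halfsq w - k * (halfsq w + s0 ^+ 2 / 2).
  exists (fun h => A1 * h + A2 * h ^+ 2), 1; split => //.
    apply: (@is_derive_quadratic _ _ _ _ _ _ A2) => h.
    by rewrite [h *: _]mulr1 -/A1; ring.
  move=> h /andP[h0 h1]; have sh0 : 0 <= s0 - h * s0.
    by rewrite -[X in X - _]mul1r -mulrBl mulr_ge0// ?subr_ge0 ltW.
  have := mx t0 (s0 - h * s0, (y0, z0 + h *: w)) t01.
  rewrite /F /pen /b /= (psi'E _ sh0) (psi'E _ (ltW s0p)) /A1 /A2 /P.
  rewrite !halfsqB !halfsqD !halfsqZ !dotE -/psi.
  lra.
have := dhP (z0 + P) (y0 + P) _.
have yz' : `|z0 + P - (y0 + P)| <= dh.
  by rewrite opprD addrACA subrr addr0 distrC (le_trans yz).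
move=> /(_ yz'); rewrite ler_norml => /andP[_ h]; lra.
Qed.

End Uniqueness.

(** * Piecewise affine limits *)

Section Discrete.
Variables (R : realType) (n : nat).

(** Each isolating neighbourhood contains a single point of [A], so a finite subcover counts the
    points of [K]. *)
Lemma discrete_compact_finite (T : ptopologicalType) (A K : set T) :
  discrete_set A -> K `<=` A -> compact K -> finite_set K.
Proof.
move=> dA KA; rewrite compact_cover => cK.
pose V x := xget setT [set V : set T | nbhs x V /\ V `&` A = [set x]].
have VP x : A x -> nbhs x (V x) /\ V x `&` A = [set x].
  move=> Ax; apply: (@xgetPex _ setT [set V : set T | nbhs x V /\ V `&` A = [set x]]).
  by have [_ [W nW WA]] := dA x Ax; exists W.
have [|x Kx|D DK cov] := cK T K (fun x => (V x)°).
- by move=> x _; exact: open_interior.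
- by exists x => //; exact: (VP x (KA x Kx)).1.
apply: sub_finite_set (finite_fset D).
move=> x Kx; have [z Dz /interior_subset zx] := cov x Kx.
have Az : A z by apply: KA; rewrite -in_setE; exact: DK.
have : (V z `&` A) x by split => //; exact: KA.
by rewrite (VP z Az).2 => ->.
Qed.

Lemma cvg_uniformP (I : Type) (F : set_system I) (FF : Filter F)
    (f : I -> 'rV[R]_n -> R) (g : 'rV[R]_n -> R) :
  (forall e, 0 < e -> \forall i \near F, forall y, `|g y - f i y| <= e) ->
  {uniform, f @ F --> g}.
Proof.
move=> H P /uniform_nbhs[E [entE EP]].
have [e /= e0 eE] : exists2 e : R, 0 < e & forall a b : R, `|a - b| < e -> E (a, b).
  move: entE; rewrite -entourage_ballE => -[e /= e0 eE].
  by exists e => // a b ab; apply: eE => /=; rewrite -ball_normE.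
have e2 : 0 < e / 2 by rewrite divr_gt0.
apply: filterS (H _ e2) => i fi; apply: EP => y _; apply: eE.
by apply: le_lt_trans (fi y) _; rewrite ltr_pdivrMr// ltr_pMr// ltr1n.
Qed.

End Discrete.

(** * Piecewise affine functions *)

Section PiecewiseAffine.
Variables (R : realType) (n : nat).

Definition locally_max_affine (f : 'rV[R]_n -> R) :=
  forall x, exists s : seq ('rV[R]_n * R), forall y, `|y - x| <= 1 ->
    (forall c, c \in s -> dot c.1 y + c.2 <= f y) /\
    exists2 c, c \in s & f y = dot c.1 y + c.2.

(** The sup-norm unit ball as half-spaces: the finite maximum is valid only there, so each
    polyhedron is cut by it. *)
Definition unit_box (x : 'rV[R]_n) : seq ('rV[R]_n * R) :=
  [seq (delta_mx 0 j, x 0 j + 1) | j <- enum 'I_n] ++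
  [seq (- delta_mx 0 j, 1 - x 0 j) | j <- enum 'I_n].

Lemma unit_boxP x y : (forall c, c \in unit_box x -> dot c.1 y <= c.2) <-> `|y - x| <= 1.
Proof.
split=> [H|yx c].
  apply: norm_le_coord => // j; rewrite !mxE ler_norml.
  have := H (delta_mx 0 j, x 0 j + 1); have := H (- delta_mx 0 j, 1 - x 0 j).
  rewrite !mem_cat !map_f ?mem_enum// orbT => /(_ isT) h1 /(_ isT).
  by move: h1; rewrite /= dotNl dotC dot_delta => h1 h2; apply/andP; split; lra.
have yxj j : - 1 <= y 0 j - x 0 j <= 1.
  by have := coord_le_norm (y - x) j; rewrite -ler_norml !mxE => /le_trans; apply.
by rewrite mem_cat => /orP[] /mapP[j _ ->] /=; have /andP[h1 h2] := yxj j;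
  rewrite ?dotNl dotC dot_delta; lra.
Qed.

Lemma locally_max_affine_piecewise f : locally_max_affine f -> piecewise_affine f.
Proof.
move=> fP x; have [s sP] := fP x.
pose c (i : 'I_(size s)) := nth (0, 0) s i.
pose ineqs i := unit_box x ++ [seq (d.1 - (c i).1, (c i).2 - d.2) | d <- s].
pose P i := [set y | forall d, d \in ineqs i -> dot d.1 y <= d.2].
have PE i y : P i y <-> `|y - x| <= 1 /\
    forall d, d \in s -> dot d.1 y + d.2 <= dot (c i).1 y + (c i).2.
  split=> [Py|[yx H] d].
    split; first by apply/unit_boxP => d db; apply: Py; rewrite mem_cat db.
    move=> d ds; have := Py (d.1 - (c i).1, (c i).2 - d.2).
    rewrite mem_cat orbC (map_f (fun d => (d.1 - (c i).1, (c i).2 - d.2)))//.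
    by move=> /(_ isT); rewrite /= !dotE; lra.
  rewrite mem_cat => /orP[|/mapP[d' /H h ->]]; first exact: ((unit_boxP x y).2 yx d).
  by rewrite /= !dotE; lra.
exists (size s), P; split=> [i|].
  split; first by exists (ineqs i).
  exists (c i).1, (c i).2 => y /PE[yx H]; have [fge [d ds fE]] := sP y yx.
  apply/eqP; rewrite eq_le fge ?mem_nth// andbT fE; exact: H.
have : \forall y \near x, `|y - x| <= 1.
  by apply/nbhs_normP; exists 1 => //= y; rewrite distrC => /ltW.
apply: filterS => y yx; have [fge [d ds fE]] := sP y yx.
have di : (index d s < size s)%N by rewrite index_mem.
exists (Ordinal di); apply/PE; split => // d' d's.
by rewrite /c /= nth_index// -fE; exact: fge.
Qed.

End PiecewiseAffine.

(** * Legendre transform over a discrete set, and its dual *)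

Section DiscreteLegendre.
Variables (R : realType) (n : nat) (A : set 'rV[R]_n) (g : 'rV[R]_n -> R).
Variables (M M1 : R).
Hypotheses (A0 : A !=set0) (clA : closed A) (dA : discrete_set A).
Hypotheses (cg : continuous g) (gM : forall x, halfsq x - M <= g x).
Let psi := legendre_on A g.
Hypothesis npsi : near_halfsq M1 psi.

Lemma discrete_ball_seq (r : R) : exists s : seq 'rV[R]_n,
  forall z, (z \in s) <-> A z /\ `|z| <= r.
Proof.
have /finite_seqP[s sE] : finite_set ([set z : 'rV[R]_n | `|z| <= r] `&` A).
  apply: (discrete_compact_finite dA); first by move=> z [].
  by apply: compact_closedI => //; exact: compact_norm_le.
exists s => z; have : [set` s] z <-> ([set z : 'rV[R]_n | `|z| <= r] `&` A) z by rewrite sE.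
by move=> /= E; split=> [/E[]|[Az zr]]; [|apply/E].
Qed.

Lemma maximizer_near z y : A z -> psi y = dot z y - g z -> `|z - y| <= 1 + 2 * (M + M1).
Proof.
move=> Az E; apply: le_trans (norm_le_halfsq _) _.
by have := gM z; have := npsi y; rewrite E halfsqB => /andP[]; lra.
Qed.

Lemma discrete_legendre_local (r : R) : exists s : seq 'rV[R]_n,
  (forall z, z \in s -> A z) /\
  forall y, `|y| <= r -> exists2 z, z \in s & psi y = dot z y - g z.
Proof.
have [s sP] := discrete_ball_seq (r + (1 + 2 * (M + M1))).
exists s; split=> [z /sP[]//|y yr].
have [z Az E] := legendre_on_attained y A0 clA gM cg.
exists z => //; apply/sP; split => //.
rewrite -(subrK y z) addrC (le_trans (ler_normD _ _))// lerD//.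
exact: maximizer_near.
Qed.

Lemma norm_le_of_dist (x y : 'rV[R]_n) c : `|y - x| <= c -> `|y| <= `|x| + c.
Proof.
by move=> yx; rewrite -(subrK x y) addrC (le_trans (ler_normD _ _))// lerD2l.
Qed.

Lemma discrete_legendre_max_affine : locally_max_affine psi.
Proof.
move=> x; have [s [sA sP]] := discrete_legendre_local (`|x| + 1).
exists [seq (z, - g z) | z <- s] => y yx; split=> [c /mapP[z /sA Az ->]|].
  exact: legendre_on_ge A0 gM _ _ Az.
have [z zs E] := sP y (norm_le_of_dist yx).
by exists (z, - g z) => //; exact: map_f.
Qed.

Lemma discrete_legendre_convex : convex_fun psi.
Proof. exact: legendre_on_convex gM. Qed.

Lemma discrete_legendre_continuous : continuous psi.
Proof. exact: convex_near_continuous discrete_legendre_convex npsi. Qed.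

Let phi := legendre psi.

Lemma biconjugate_hull : lower_convex_hull A g phi.
Proof.
split; first exact: legendre_convex npsi.
  move=> x Ax; apply: (legendre_le npsi) => y.
  by have := legendre_on_ge A0 gM y Ax; rewrite dotC -/psi; lra.
move=> h ch hA x; exact: (convex_le_biconjugate A0 gM npsi ch hA).
Qed.

Lemma dual_maximizer x : exists y, phi x = dot x y - psi y.
Proof.
have T0 : [set: 'rV[R]_n] !=set0 by exists 0.
have lo y : halfsq y - M1 <= psi y by case/andP: (npsi y).
have [y _ E] := legendre_on_attained x T0 closedT lo discrete_legendre_continuous.
by exists y; rewrite dotC.
Qed.

Lemma dual_maximizer_near x y : phi x = dot x y - psi y -> `|y - x| <= 1 + 4 * M1.
Proof.
move=> E; apply: le_trans (norm_le_halfsq _) _.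
have := legendre_near npsi x; have := npsi y.
by rewrite -/phi E halfsqB (dotC y) => /andP[h1 h2] /andP[h3 h4]; lra.
Qed.

Section Extremal.
Variable x0 : 'rV[R]_n.
(** This radius contains every dual maximizer of the points within distance 1 of [x0]; [sP] reaches
    one unit further, to allow for a neighbourhood of each. *)
Let r0 := `|x0| + 1 + (1 + 4 * M1).
Variable s : seq 'rV[R]_n.
Hypothesis sA : forall z, z \in s -> A z.
Hypothesis sP : forall y, `|y| <= r0 + 1 -> exists2 z, z \in s & psi y = dot z y - g z.

Definition active y : {set 'I_(size s)} :=
  [set i : 'I_(size s) | psi y == dot s`_i y - g s`_i].

(** The finitely many pieces inactive at [y] stay strictly below [psi] nearby, so a piece attaining
    [psi] there is active at [y]. *)
Lemma active_local y : `|y| <= r0 ->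
  exists2 r, 0 < r & forall z, `|z - y| < r ->
    exists2 i, i \in active y & psi z = dot s`_i z - g s`_i.
Proof.
move=> yr.
have evi (i : 'I_(size s)) : \forall z \near y, i \notin active y ->
    dot s`_i z - g s`_i < psi z.
  have [ia|ia] := boolP (i \in active y).
    by apply/nbhs_normP; exists 1 => //= z.
  have lt : 0 < psi y - (dot s`_i y - g s`_i).
    rewrite subr_gt0 lt_neqAle (legendre_on_ge A0 gM _ (sA _)) ?mem_nth// andbT.
    by move: ia; rewrite inE eq_sym.
  have c : continuous (fun z => psi z - (dot s`_i z - g s`_i)).
    apply: continuous_subf; first exact: discrete_legendre_continuous.
    apply: continuous_subf; last exact: cst_continuous.
    apply: (@continuous_dot _ _ _ (cst s`_i) id); first exact: cst_continuous.
    by move=> z; exact: cvg_id.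
  have /cvgrPdist_lt/(_ _ lt)/nbhs_normP[r /= r1 rP] := c y.
  apply/nbhs_normP; exists r => //= z /rP /= + _; rewrite ltr_norml => /andP[_].
  lra.
have ev : \forall z \near y, forall i : 'I_(size s), i \notin active y ->
    dot s`_i z - g s`_i < psi z.
  exact: (@filter_forall _ _ _ _ (nbhs_filter y) evi).
move: ev => /nbhs_normP[r /= r1 rP].
exists (Num.min r 1); first by rewrite lt_min r1 ltr01.
move=> z; rewrite lt_min => /andP[zr z1].
have [w ws E] := sP (le_trans (norm_le_of_dist (ltW z1)) (lerD yr (lexx 1))).
have iw : (index w s < size s)%N by rewrite index_mem.
exists (Ordinal iw); last by rewrite /= nth_index.
apply/negPn/negP => /(rP z _).
by rewrite /= distrC nth_index// -E ltxx => /(_ zr).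
Qed.

(** Geometrically, a vertex of the subdivision cut out by the affine pieces of [s]. Such a point is
    determined by its active set, so there are only finitely many of them. *)
Definition extremal y := forall y', active y \subset active y' -> y' = y.

(* A maximizer with as many active affine pieces as possible: if the active
   pieces of [y] were also active at [y' != y], one could follow the ray from
   [y] through [y'] until a further piece becomes active. *)
Lemma extremal_maximizer x : `|x - x0| <= 1 ->
  exists2 y, phi x = dot x y - psi y & extremal y.
Proof.
move=> xx0.
have near_max y : phi x = dot x y - psi y -> `|y| <= r0.
  move=> /dual_maximizer_near/norm_le_of_dist/le_trans; apply.
  by rewrite /r0 lerD2r; exact: norm_le_of_dist.
pose P (I : {set 'I_(size s)}) := `[< exists2 y, phi x = dot x y - psi y & active y = I >].
have [y1 y1max] := dual_maximizer x.
have P1 : P (active y1) by apply/asboolP; exists y1.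
case: (arg_maxnP (fun I : {set 'I_(size s)} => #|I|) P1) => I /asboolP[y ymax <-] cardmax.
exists y => // y' sub; apply/eqP/negPn/negP => yy'.
have [d dE] : exists d, d = y' - y by exists (y' - y).
have d0 : 0 < `|d| by rewrite dE normr_gt0 subr_eq0.
pose c := psi y' - psi y.
have dc i : i \in active y -> dot s`_i d = c.
  move=> iy; have := fintype.subsetP sub i iy; move: iy; rewrite !inE => /eqP e1 /eqP e2.
  by rewrite /c dE e1 e2 !dotE; ring.
have ray i (t : R) : i \in active y ->
    dot s`_i (y + t *: d) - g s`_i = psi y + t * c.
  by move=> iy; have := dc i iy; move: iy; rewrite inE => /eqP e1 e2; rewrite e1 -e2 !dotE; ring.
have dsmall z t r : 0 < r -> `|t| < r / (`|d| + 1) -> `|z + t *: d - z| < r.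
  move=> r1; have d1 : 0 < `|d| + 1 by rewrite addr_gt0.
  rewrite ltr_pdivlMr// addrAC subrr add0r normrZ; apply: le_lt_trans.
  by rewrite ler_wpM2l// lerDl.
have local z t0 : `|z| <= r0 -> active z = active y -> z = y + t0 *: d ->
    exists2 e, 0 < e & forall t, `|t| < e -> psi (y + (t0 + t) *: d) = psi y + (t0 + t) * c.
  move=> zr az zE; have [r r1 rP] := active_local zr.
  exists (r / (`|d| + 1)); first by rewrite divr_gt0// addr_gt0.
  move=> t /(dsmall z t r r1)/rP; rewrite az => -[i iy].
  by rewrite zE -addrA -scalerDl ray.
have [e e0 eP] : exists2 e, 0 < e & forall t, `|t| < e -> psi (y + t *: d) = psi y + t * c.
  have [|e e0 eP] := local y 0 (near_max y ymax) erefl; first by rewrite scale0r addr0.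
  by exists e => // t /eP; rewrite !add0r.
(* Near [y] along [d], the function maximized at [y] is affine in [t]; an affine function with an
   interior maximum is constant. *)
have xd : dot x d = c.
  have le t : `|t| < e -> t * (dot x d - c) <= 0.
    move=> /eP te; have := legendre_ge (y + t *: d) x npsi.
    by rewrite -/phi ymax te dotC !dotE; lra.
  have e2 : 0 < e / 2 by rewrite divr_gt0.
  have ee : `|e / 2| < e by rewrite gtr0_norm// ltr_pdivrMr// ltr_pMr// ltr1n.
  have := le _ ee; have := le (- (e / 2)); rewrite normrN => /(_ ee).
  rewrite mulNr oppr_le0 pmulr_rge0// pmulr_rle0//; lra.
(* All points of the ray with parameter in [J] are maximizers, and by maximal cardinality none has
   more active pieces than [y]. So [J] is bounded because maximizers are, contains its supremum by
   continuity, and yet extends beyond it by [active_local]. *)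
pose J := [set t : R | 0 <= t /\ psi (y + t *: d) = psi y + t * c].
have Jmax t : J t -> phi x = dot x (y + t *: d) - psi (y + t *: d) /\
    active (y + t *: d) = active y.
  move=> [t0 te]; have tmax : phi x = dot x (y + t *: d) - psi (y + t *: d).
    by rewrite te ymax !dotE xd; ring.
  split => //; apply/esym/eqP; rewrite eqEcard; apply/andP; split.
    by apply/fintype.subsetP => i iy; rewrite inE ray// te.
  by apply: cardmax; apply/asboolP; exists (y + t *: d).
have J0 : J 0 by split => //; rewrite scale0r mul0r !addr0.
have Jub : has_sup J.
  split; first by exists 0.
  exists ((r0 + `|y|) / `|d|) => t Jt; have [tmax _] := Jmax t Jt.
  have := near_max _ tmax; rewrite ler_pdivlMr// => h.
  have -> : t * `|d| = `|y + t *: d - y|.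
    by rewrite addrAC subrr add0r normrZ ger0_norm//; case: Jt.
  by apply: le_trans (ler_normB _ _) _; rewrite lerD2r.
pose ts := sup J.
have ts0 : 0 <= ts by apply: ub_le_sup; [case: Jub|exact: J0].
have Jts : J ts.
  split => //; apply/eqP; rewrite -subr_eq0; apply/eqP.
  pose k t := psi (y + t *: d) - (psi y + t * c).
  have ck : continuous k.
    apply: continuous_subf.
      apply: (continuous_compf discrete_legendre_continuous).
      by move=> t; apply: cvgD; [exact: cvg_cst|apply: cvgZr_tmp; exact: cvg_id].
    apply: continuous_addf; first exact: cst_continuous.
    by apply: continuous_mulf; [move=> t; exact: cvg_id|exact: cst_continuous].
  rewrite -/(k ts); apply/eqP/negPn/negP => kts.
  have kts0 : 0 < `|k ts| by rewrite normr_gt0.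
  have /cvgrPdist_lt/(_ _ kts0)/nbhs_normP[r /= r1 rP] := ck ts.
  have [t Jt tlt] : exists2 t, J t & ts - r < t.
    by apply: sup_adherent.
  have tts : t <= ts by apply: ub_le_sup; [case: Jub|].
  have := rP t; rewrite /= ger0_norm ?subr_ge0//.
  have tr : ts - t < r by lra.
  by move=> /(_ tr); case: Jt => _ te; rewrite {2}/k te subrr subr0 ltxx.
have [tsmax tsact] := Jmax ts Jts.
have [r r1 rP] := local _ ts (near_max _ tsmax) tsact erefl.
have r2 : 0 < r / 2 by rewrite divr_gt0.
have : J (ts + r / 2).
  split; first by rewrite addr_ge0// ltW.
  by apply: rP; rewrite gtr0_norm// ltr_pdivrMr// ltr_pMr// ltr1n.
have [_ Jb] := Jub.
by move=> /(ub_le_sup Jb); rewrite -/ts; lra.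
Qed.

End Extremal.

Lemma biconjugate_max_affine : locally_max_affine phi.
Proof.
move=> x0.
have [s [sA sP]] := discrete_legendre_local (`|x0| + 1 + (1 + 4 * M1) + 1).
(* The default 0, taken when [J] is the active set of no extremal point, is harmless: every [y]
   yields an affine function below [phi]. *)
pose yI (J : {set 'I_(size s)}) := xget 0 [set y | active s y = J /\ extremal s y].
exists [seq (yI J, - psi (yI J)) | J <- enum {set 'I_(size s)}] => x xx0.
split=> [c /mapP[J _ ->]|].
  exact: legendre_ge npsi.
have [y ymax yext] := extremal_maximizer sA sP xx0.
have yE : yI (active s y) = y.
  have [a _] : [set y' | active s y' = active s y /\ extremal s y'] (yI (active s y)).
    by apply: xgetPex; exists y.
  by apply: yext; rewrite a.
exists (yI (active s y), - psi (yI (active s y))).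
  by apply: map_f; rewrite mem_enum.
by rewrite yE dotC.
Qed.

End DiscreteLegendre.

(** * Long-time convergence *)

Section LongTime.
Variables (R : realType) (n : nat) (L : set 'rV[R]_n).
Variables (psi0 H : 'rV[R]_n -> R) (M hb : R) (A : set 'rV[R]_n).
Hypotheses (HL : unimodular_lattice L) (CLpsi0 : CL L psi0).
Hypotheses (npsi0 : near_halfsq M psi0) (cH : continuous H) (pH : periodic L H).
Hypotheses (H0 : forall x, 0 <= H x) (Hb : forall x, H x <= hb).
Hypotheses (A0 : A !=set0) (AH : forall x, A x <-> H x = 0).
Let phi0 := legendre psi0.
Let psi := hopf psi0 H.

Lemma zeros_periodic x l : L l -> A x -> A (x + l).
Proof. by move=> Ll /AH Hx; apply/AH; rewrite pH. Qed.

Lemma zeros_closed : closed A.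
Proof.
have -> : A = H @^-1` [set 0] by apply/seteqP; split=> x /AH.
apply: preimage_closed; first by move=> x _; exact: cH.
exact: closed_eq.
Qed.

(** Away from the [d]-neighbourhood of the zeros, periodicity leaves a compact set on which [H] has
    a positive minimum. *)
Lemma small_near_zeros (d : R) : 0 < d ->
  exists2 c, 0 < c & forall x, H x < c -> exists2 z, A z & `|x - z| <= d.
Proof.
move=> d0; have [D D0 DP] := lattice_covering HL.
pose far := \bigcap_(z in A) [set x : 'rV[R]_n | d <= `|x - z|].
have clfar : closed far.
  apply: closed_bigI => z _.
  apply: (@preimage_closed _ _ (fun x : 'rV[R]_n => `|x - z|) [set r | d <= r]).
    have c1 : continuous (fun x : 'rV[R]_n => x - z).
      by move=> w; apply: continuousB; [exact: cvg_id|exact: cst_continuous].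
    by move=> x _; exact: (continuous_compf (@norm_continuous _ _) c1).
  exact: closed_ge.
pose K := [set x : 'rV[R]_n | `|x| <= D] `&` far.
have cK : compact K by apply: compact_closedI => //; exact: compact_norm_le.
have [c c0 cP] : exists2 c, 0 < c & forall x, K x -> c <= H x.
  have [K0|K0] := pselect (K !=set0); last first.
    by exists 1 => // x Kx; exfalso; apply: K0; exists x.
  have [|x] := compact_EVT_min K0 cK (f := H); first exact: continuous_subspaceT.
  rewrite inE => -[_ xfar] xmin; exists (H x); last by move=> y Ky; apply: xmin; rewrite inE.
  rewrite lt_neqAle H0 andbT eq_sym; apply/eqP => /AH Ax.
  by have := xfar x Ax; rewrite /= subrr normr0 leNgt d0.
exists c => // x xc; apply/not_exists2P => nz.
have [l Ll xl] := DP x; have : K (x + l).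
  split => // z Az /=; have := nz (z - l).
  have Azl : A (z - l) by apply: zeros_periodic => //; exact: (latticeN HL).
  by move=> [//|/negP]; rewrite -ltNge opprB addrA => /ltW.
by move=> /cP; rewrite pH// leNgt xc.
Qed.

(** At a maximizer [x] the two-sided bounds give [t * H x <= M + M1], whatever [y] is, so for large
    [t] a zero [z] of [H] is near. Exchanging [x] for [z] costs the variation of the periodic
    function [phi0 - halfsq] and a difference of half squares, each at most [e / 2]. *)
Lemma hopf_long_time (e : R) : 0 < e ->
  exists T, forall t, T <= t -> forall y, `|legendre_on A phi0 y - psi t y| <= e.
Proof.
move=> e0; have [M1 M1P] := legendre_on_near HL npsi0 A0 zeros_periodic.
have nphi0 := legendre_near npsi0.
have lo x : halfsq x - M <= phi0 x by case/andP: (nphi0 x).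
pose p x := phi0 x - halfsq x.
have cp : continuous p.
  apply: continuous_subf; first exact: legendre_continuous npsi0.
  by apply: continuous_halfsq => x; exact: cvg_id.
have pp : periodic L p := (phi0_CL HL CLpsi0 npsi0).2.
have e2 : 0 < e / 2 by rewrite divr_gt0.
have [d d0 dP] := periodic_uniform1 HL cp pp e2.
have MM : 0 <= M + M1 by have := M1P 0; have := npsi0 0; rewrite !halfsq0; lra.
pose C := 1 + 2 * (M + M1); have C0 : 0 < C by rewrite /C; lra.
pose E := n%:R * (C + 1); have E0 : 0 <= E by rewrite mulr_ge0//; lra.
have [del [del0 del1 deld delE]] :
    exists del, [/\ 0 < del, del <= 1, del <= d & E * del <= e / 2].
  exists (Num.min (Num.min 1 d) (e / 2 / (E + 1))).
  have E1 : 0 < E + 1 by lra.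
  have h : 0 < e / 2 / (E + 1) by rewrite divr_gt0.
  rewrite !lt_min !ge_min !lexx !orbT ltr01 d0 h; split => //.
  set m := Num.min _ _; have : m <= e / 2 / (E + 1) by rewrite /m ge_min lexx orbT.
  rewrite ler_pdivlMr// => hm; apply: le_trans hm; rewrite mulrC ler_wpM2l//; last by lra.
  by rewrite /m !le_min ler01 !ltW.
have [c c0 cP] := small_near_zeros del0.
exists (1 + (M + M1) / c) => t tT y.
have t0 : 0 < t by apply: lt_le_trans tT; rewrite ltr_pwDl// divr_ge0// ltW.
have le1 : legendre_on A phi0 y <= psi t y.
  by apply: (hopf_ge_legendre_on npsi0 H0 Hb t y A0) => x /AH.
rewrite ler0_norm ?subr_le0// opprB.
have [x xE] := hopf_attained npsi0 cH H0 Hb t y; rewrite -/phi0 -/psi in xE.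
have lox := lo x; have hiM : halfsq y - M1 <= psi t y.
  by apply: le_trans le1; case/andP: (M1P y).
have tH := mulr_ge0 (ltW t0) (H0 x); have hq := halfsq_ge0 (x - y).
have hxy : `|x - y| <= C.
  apply: le_trans (norm_le_halfsq _) _; rewrite halfsqB xE in hq hiM *; rewrite /C; lra.
have Hx : H x < c.
  have : t * H x <= M + M1 by rewrite halfsqB xE in hq hiM; lra.
  have : (M + M1) / c < t by lra.
  rewrite ltr_pdivrMr// => h1 h2; rewrite -(ltr_pM2l t0); lra.
have [z Az xz] := cP x Hx.
have := legendre_on_ge A0 lo y Az.
have := dP x z (le_trans xz deld); rewrite /p ler_norml => /andP[h1 _] h2.
have -> : e = e / 2 + e / 2 by rewrite -splitr.
have : halfsq (z - y) - halfsq (x - y) <= e / 2.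
  have -> : z - y = (x - y) + (z - x) by apply/rowP => i; rewrite !mxE; ring.
  rewrite halfsqD; have zx : `|z - x| <= del by rewrite distrC.
  have h3 : dot (x - y) (z - x) <= n%:R * (C * del).
    apply: le_trans (ler_norm _) _; apply: le_trans (norm_dot_le _ _) _.
    by rewrite ler_wpM2l// ler_pM.
  have h4 : dot (z - x) (z - x) <= n%:R * (1 * del).
    apply: le_trans (ler_norm _) _; apply: le_trans (norm_dot_le _ _) _.
    by rewrite ler_wpM2l// ler_pM// (le_trans zx).
  have := dot_ge0 (z - x); rewrite /E in delE.
  have -> : halfsq (z - x) = dot (z - x) (z - x) / 2 by [].
  by lra.
rewrite !halfsqB xE; lra.
Qed.

End LongTime.

(** * The parabolic Monge-Ampere flow *)

Section Determinant.
Variables (R : realType) (n : nat).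

Lemma norm_det_le (B : 'M[R]_n) (C : R) : (forall i j, `|B i j| <= C) ->
  `|\det B| <= n`!%:R * C ^+ n.
Proof.
move=> BC; apply: le_trans (ler_norm_sum _ _ _) _.
rewrite mulr_natl -perm.card_Sn -sumr_const; apply: ler_sum => s _.
rewrite normrM normrX normrN1 expr1n mul1r normr_prod.
rewrite -[X in _ <= _ ^+ X]card_ord -prodr_const.
by apply: ler_prod => i _; rewrite normr_ge0 BC.
Qed.

(* The inverse of a matrix with lower bound [c] has entries at most [1/c]. *)
Lemma det_ge_coercive (B : 'M[R]_n) (c : R) : 0 < c -> 0 < \det B ->
  (forall w : 'rV[R]_n, c * dot w w <= dot w (w *m B)) ->
  c ^+ n / n`!%:R <= \det B.
Proof.
move=> c0 detB coer; have uB : B \in unitmx by rewrite unitmxE unitfE gt_eqF.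
have ent i j : `|invmx B i j| <= c^-1.
  pose w := row i (invmx B).
  have wB : w *m B = delta_mx 0 i.
    by rewrite /w rowE -mulmxA mulVmx// mulmx1.
  have := coer w; rewrite wB dot_delta => h.
  have h1 := coord_sq_le_dot w i; have h2 := coord_sq_le_dot w j.
  have wi : c * w 0 i <= 1.
    have [wi|wi] := leP (w 0 i) 0; first by have := mulr_ge0_le0 (ltW c0) wi; lra.
    have : c * w 0 i ^+ 2 <= w 0 i by apply: le_trans h; rewrite ler_wpM2l// ltW.
    by rewrite expr2 mulrA -[leRHS]mul1r ler_pM2r.
  have -> : invmx B i j = w 0 j by rewrite mxE.
  rewrite -(ler_pM2l c0) divff ?gt_eqF// -[c]gtr0_norm// -normrM.
  rewrite -(@ler_pXn2r _ 2)// ?nnegrE// real_normK ?num_real// expr1n exprMn.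
  have : c * w 0 j ^+ 2 <= w 0 i by apply: le_trans h; rewrite ler_wpM2l// ltW.
  by move=> /(ler_wpM2l (ltW c0)); lra.
have := norm_det_le ent; rewrite det_inv normfV (gtr0_norm detB).
have f0 : 0 < n`!%:R :> R by rewrite ltr0n fact_gt0.
rewrite invf_ple ?posrE//; last by rewrite mulr_gt0// exprn_gt0// invr_gt0.
by rewrite invfM exprVn invrK mulrC.
Qed.

End Determinant.

(** * Hessians of smooth functions *)

Section SecondDerivatives.
Variables (R : realType) (n : nat).
Implicit Types (f : 'rV[R]_n -> R).

Lemma smooth_differentiable f x : smooth_on [set: 'rV[R]_n] f -> differentiable f x.
Proof. by move=> sf; exact: (sf [::] x I). Qed.

Lemma smooth_derive f v : smooth_on [set: 'rV[R]_n] f -> smooth_on [set: 'rV[R]_n] ('D_v f).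
Proof.
move=> sf vs x _; have := sf (rcons vs v) x I.
suff -> : iter_derive (rcons vs v) f = iter_derive vs ('D_v f) by [].
by elim: vs => //= w vs ->.
Qed.

Lemma smooth_continuous f : smooth_on [set: 'rV[R]_n] f -> continuous f.
Proof.
by move=> sf x; apply: differentiable_continuous; exact: smooth_differentiable.
Qed.

Lemma derive_space (f : R * 'rV[R]_n -> R) t y w :
  'D_w (fun z => f (t, z)) y = 'D_(0, w) f (t, y).
Proof.
have E : (fun h : R => h^-1 *: ((f \o shift (t, y)) (h *: (0, w)) - f (t, y))) =
  (fun h : R => h^-1 *: (((fun z => f (t, z)) \o shift y) (h *: w) - f (t, y))).
  by apply/funext => h; rewrite /shift /comp pair_space_shift.
by rewrite /derive E.
Qed.

Lemma smooth_slice (u : R -> 'rV[R]_n -> R) t : 0 < t ->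
  smooth_on (@pos_times R n) (spacetime u) -> smooth_on [set: 'rV[R]_n] (u t).
Proof.
move=> t0 su vs x _.
have E : iter_derive vs (u t) =
    (fun z => iter_derive [seq (0, v) | v <- vs] (spacetime u) (t, z)).
  elim: vs => //= v vs ->; apply/funext => y; exact: derive_space.
rewrite E; have := su [seq (0, v) | v <- vs] (t, x) t0.
set g := iter_derive _ _ => dg.
apply: (@differentiable_comp _ _ _ _ (fun z => (t, z)) g) => //.
Qed.

Lemma hessian_form f x w : smooth_on [set: 'rV[R]_n] f ->
  dot w (w *m hessian f x) = 'D_w ('D_w f) x.
Proof.
move=> sf.
have -> : 'D_w f = \sum_(j < n) (w 0 j *: 'D_(delta_mx 0 j) f).
  apply/funext => y; rewrite derive_coord; last exact: smooth_differentiable.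
  by rewrite fct_sumE.
have dd j : derivable (w 0 j *: 'D_(delta_mx 0 j) f) x w.
  by apply/derivableZ/diff_derivable/smooth_differentiable/smooth_derive.
rewrite derive_sum//; apply: eq_bigr => j _.
rewrite deriveZ; last by apply/diff_derivable/smooth_differentiable/smooth_derive.
rewrite derive_coord; last by apply/smooth_differentiable/smooth_derive.
by rewrite mxE [RHS]/GRing.scale/=; congr (_ * _); apply: eq_bigr => i _; rewrite mxE.
Qed.

Lemma hessian_sym f x i j : smooth_on [set: 'rV[R]_n] f ->
  hessian f x i j = hessian f x j i.
Proof.
move=> sf; rewrite !mxE; apply: derive_symmetric => [y|y|y|y||].
- by apply/diff_derivable/smooth_differentiable.
- by apply/diff_derivable/smooth_differentiable.
- by apply/diff_derivable/smooth_differentiable/smooth_derive.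
- by apply/diff_derivable/smooth_differentiable/smooth_derive.
- by apply/smooth_continuous/smooth_derive/smooth_derive.
- by apply/smooth_continuous/smooth_derive/smooth_derive.
Qed.

(** Polarization with [e i], [e j] and [e i + e j]; the last has sup norm 2 when [i = j], hence the
    range of [w]. *)
Lemma hessian_entry_le f x (C : R) : smooth_on [set: 'rV[R]_n] f ->
  (forall w : 'rV[R]_n, `|w| <= 2 -> 0 <= 'D_w ('D_w f) x <= C) ->
  forall i j, `|hessian f x i j| <= C.
Proof.
move=> sf fC i j; set A := hessian f x.
pose e k : 'rV[R]_n := delta_mx 0 k.
have ne k : `|e k| <= 1.
  by apply: norm_le_coord => // l; rewrite !mxE ger0_norm ?ler0n// lern1; case: (_ && _).
have eA k l : dot (e k) (e l *m A) = A l k.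
  by rewrite dotC dot_delta -rowE mxE.
have := fC (e i + e j); have := fC (e i); have := fC (e j).
rewrite -!hessian_form// -/A mulmxDl !dotE !eA (hessian_sym x j i sf) -/A.
have n1 k : `|e k| <= 2 by rewrite (le_trans (ne k))// ler1n.
have n2 : `|e i + e j| <= 2 by rewrite (le_trans (ler_normD _ _))// (le_trans (lerD (ne i) (ne j))).
move=> /(_ (n1 j)) /andP[h1 h2] /(_ (n1 i)) /andP[h3 h4] /(_ n2) /andP[h5 h6].
rewrite ler_norml; apply/andP; split; lra.
Qed.

Lemma form_le_entries f x w (C : R) : smooth_on [set: 'rV[R]_n] f ->
  (forall i j, `|hessian f x i j| <= C) -> `|w| <= 2 ->
  `|'D_w ('D_w f) x| <= n%:R * (2 * (n%:R * (2 * C))).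
Proof.
move=> sf fC w2; rewrite -hessian_form//.
apply: le_trans (norm_dot_le _ _) _; rewrite ler_wpM2l// ler_pM//.
have [i0|C0] := pselect (exists i : 'I_n, True); last first.
  apply: norm_le_coord => [|i]; last by exfalso; apply: C0; exists i.
  case: n C0 => [|m] C0; first by rewrite mul0r.
  by exfalso; apply: C0; exists ord0.
have C0 : 0 <= C by case: i0 => i _; exact: le_trans (fC i i).
apply: norm_le_coord => [|j]; first by rewrite !mulr_ge0.
rewrite mxE; apply: le_trans (ler_norm_sum _ _ _) _.
rewrite mulr_natl -[X in _ *+ X]card_ord -sumr_const; apply: ler_sum => i _.
by rewrite normrM ler_pM// (le_trans (coord_le_norm w i)).
Qed.

Lemma derive_translate f x l v : 'D_v f (x + l) = 'D_v (fun y => f (y + l)) x.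
Proof.
have E : (fun h : R => h^-1 *: ((f \o shift (x + l)) (h *: v) - f (x + l))) =
  (fun h : R => h^-1 *: (((fun y => f (y + l)) \o shift x) (h *: v) - f (x + l))).
  by apply/funext => h; rewrite /shift /comp /= addrA.
by rewrite /derive E.
Qed.

(** Translation changes [f] by an affine function, so its Hessian is periodic. The parameter [a]
    covers [phi0] with [a = 1] and [H] with [a = 0]. *)
Lemma hessian_bounded (L : set 'rV[R]_n) f (a : R) : unimodular_lattice L ->
  smooth_on [set: 'rV[R]_n] f ->
  (forall l, L l -> exists c, forall y, f (y + l) = f y + a * dot y l + c) ->
  exists2 C, 0 <= C & forall x i j, `|hessian f x i j| <= C.
Proof.
move=> HL sf shift.
have bij (ij : 'I_n * 'I_n) : exists C, forall x, `|hessian f x ij.1 ij.2| <= C.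
  case: ij => i j /=; pose h x := hessian f x i j.
  apply: (periodic_bounded1 HL (g := h)).
    have -> : h = 'D_(delta_mx 0 i) ('D_(delta_mx 0 j) f) by apply/funext => x; rewrite /h mxE.
    exact/smooth_continuous/smooth_derive/smooth_derive.
  move=> x l Ll; have [c lc] := shift l Ll.
  rewrite /h !mxE (derive_translate ('D_(delta_mx 0 j) f) x l).
  have -> : (fun y => 'D_(delta_mx 0 j) f (y + l)) =
      'D_(delta_mx 0 j) f + cst (a * l 0 j).
    apply/funext => y; rewrite derive_translate.
    have -> : (fun y => f (y + l)) = f + (fun y => a * dot y l + c).
      by apply/funext => z; rewrite lc addrA.
    have d : is_derive y (delta_mx 0 j) (fun y => a * dot y l + c) (a * l 0 j).
      apply: (@is_derive_quadratic _ _ _ _ _ _ 0) => t.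
      by rewrite !dotE (dotC _ l) dot_delta; ring.
    rewrite deriveD; last by case: d.
      by rewrite (@derive_val _ _ _ _ _ _ _ d).
    by apply/diff_derivable/smooth_differentiable.
  rewrite deriveD; last exact: derivable_cst.
    by rewrite derive_cst addr0.
  by apply/diff_derivable/smooth_differentiable/smooth_derive.
have /choice[C CP] := bij.
exists (\sum_ij `|C ij|) => [|x i j]; first by rewrite sumr_ge0.
rewrite (bigD1 (i, j))//= -[leLHS]addr0 lerD//; last by rewrite sumr_ge0.
by apply: le_trans (CP (i, j) x) _; exact: ler_norm.
Qed.

End SecondDerivatives.

(** * Upper and lower bounds on the flow, and its limit *)

Section Flow.
Variables (R : realType) (n : nat) (L : set 'rV[R]_n).
Variables (psi0 H : 'rV[R]_n -> R) (M hb : R) (A : set 'rV[R]_n).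
Hypotheses (HL : unimodular_lattice L) (CLpsi0 : CL L psi0).
Hypotheses (npsi0 : near_halfsq M psi0) (cH : continuous H) (pH : periodic L H).
Hypotheses (H0 : forall x, 0 <= H x) (Hb : forall x, H x <= hb).
Hypotheses (A0 : A !=set0) (AH : forall x, A x <-> H x = 0).
Let phi0 := legendre psi0.
Let psi := hopf psi0 H.
Let nphi0 : near_halfsq M phi0 := legendre_near npsi0.
Hypotheses (sphi0 : smooth_on [set: 'rV[R]_n] phi0).
Hypotheses (sH : smooth_on [set: 'rV[R]_n] H).

Lemma is_derive_backward (u : R -> R) (t a : R) : is_derive t 1 u a ->
  is_derive (0 : R) 1 (fun h => u (t - h * t)) (- (a * t)).
Proof.
move=> du; rewrite -mulrN.
apply: (@is_derive1_comp _ u (fun h => t - h * t)).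
  by rewrite mul0r subr0.
apply: (@is_derive_quadratic _ _ _ _ _ _ 0) => h.
by rewrite [h *: _]mulr1; ring.
Qed.

Lemma is_derive_forward (u : R -> R) (t a : R) : is_derive t 1 u a ->
  is_derive (0 : R) 1 (fun h => u (t + h)) a.
Proof.
move=> /(is_derive_lineP u t 1 a).1.
by have -> : (fun h : R => u (h *: 1 + t)) = (fun h => u (t + h)) by
  apply/funext => h; rewrite [h *: 1]mulr1 addrC.
Qed.

Lemma le_of_bounds (a b c t T E E' : R) : `|a| <= E -> `|b| <= E' ->
  0 <= t <= T -> 0 <= a + t * b - c -> c <= E + T * E'.
Proof.
move=> aE bE /andP[t0 tT]; have E0 : 0 <= E' := le_trans (normr_ge0 _) bE.
have h : t * b <= T * E'.
  apply: le_trans (ler_wpM2r E0 tT); rewrite ler_wpM2l//.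
  exact: le_trans (ler_norm _) bE.
by have := le_trans (ler_norm _) aE; lra.
Qed.

Section OneFlow.
Variables (beta : R) (phi : R -> 'rV[R]_n -> R).
Hypotheses (beta0 : 0 < beta) (flow : monge_ampere_flow H L beta phi0 phi).

Let phi' t := phi (Num.max 0 t).

Let phiCL t : 0 <= t -> CL L (phi t).
Proof. by case: flow => + _ _ _ _; apply. Qed.

Let phicont : {within @nonneg_times R n, continuous (spacetime phi)}.
Proof. by case: flow. Qed.

Let cphi' : continuous (fun p : R * 'rV[R]_n => phi' p.1 p.2).
Proof. exact: continuous_clamp. Qed.

Let phi'E t : 0 <= t -> phi' t = phi t.
Proof. by move=> t0; rewrite /phi' max_r. Qed.

Let phi_init : phi 0 = phi0.
Proof. by case: flow. Qed.

Let sphi t : 0 < t -> smooth_on [set: 'rV[R]_n] (phi t).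
Proof. by move=> t0; apply: smooth_slice => //; case: flow. Qed.

Let det_gt0 t x : 0 < t -> 0 < \det (hessian (phi t) x).
Proof. by case: flow => _ _ _ _ + t0 => /(_ t t0)[_ /(_ x)[]]. Qed.

Let phi_derive (t : R) x : 0 < t -> is_derive t 1 (fun s => phi s x)
  (beta^-1 * ln (\det (hessian (phi t) x)) + H x).
Proof.
case: flow => _ _ _ sm eqn t0.
have d : is_derive (t, x) (1, 0) (spacetime phi) ('D_(1, 0) (spacetime phi) (t, x)).
  by apply/derivableP/diff_derivable; exact: (sm [::] (t, x) t0).
have [dr dE] := (is_derive_time (spacetime phi) t x _).1 d; split; first exact: dr.
have [_ /(_ x)[_ <-]] := eqn t t0.
by rewrite derive1E.
Qed.

(* At a maximum of [phi - phi0 - t H] the Hessian of [phi] is bounded, so that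
   the determinant contributes at most O(1/beta). *)
Lemma flow_upper (C D : R) (t1 eta : R) :
  (forall x i j, `|hessian phi0 x i j| <= C) ->
  (forall x i j, `|hessian H x i j| <= D) ->
  0 < t1 -> 0 < eta ->
  beta^-1 * ln (1 + n`!%:R * (n%:R * (2 * (n%:R * (2 * C))) +
    2 * t1 * (n%:R * (2 * (n%:R * (2 * D))))) ^+ n) < eta ->
  forall x, phi t1 x <= phi0 x + t1 * H x + eta * t1.
Proof.
move=> HC HD t10 eta0 small x1.
have [rho rho0 rhoP] := lattice_covering HL.
pose F t x := phi' t x - (phi0 x + t * H x).
suff : F t1 x1 <= 0 + eta * t1 by rewrite /F (phi'E (ltW t10)); lra.
apply: (@time_max _ _ F [set x | `|x| <= rho] 0 eta t1) => //.
- exact: compact_norm_le.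
- by exists 0; rewrite /= normr0 ltW.
- apply: continuous_subf => //; apply: continuous_addf.
    by apply: (continuous_compf (f := phi0)); [exact: legendre_continuous npsi0|exact: continuous_snd].
  apply: continuous_mulf; first exact: continuous_fst.
  by apply: (continuous_compf (f := H)) => //; exact: continuous_snd.
- move=> t x /andP[t0 _]; have [l Ll xl] := rhoP x; exists (x + l) => //.
  have := CL_shift x (phi0_CL HL CLpsi0 npsi0) Ll; rewrite -/phi0 => sh.
  by rewrite /F phi'E// pH// (CL_shift _ (phiCL t0) Ll) sh; lra.
- by move=> x; rewrite /F phi'E// phi_init mul0r addr0 subrr.
move=> K N t0 x0 K0 t0T _ mx; have [t0p t0T'] := andP t0T.
have t0n : 0 <= t0 by exact: ltW.
pose dg := eta + K * (N.+1%:R * t0 ^+ N).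
have dg_ge : eta <= dg by rewrite lerDl mulr_ge0// mulr_ge0// exprn_ge0// ltW.
set T := 2 * t1 in t0T t0T' mx small.
pose ft := beta^-1 * ln (\det (hessian (phi t0) x0)) + H x0.
(* The maximum is interior in time, so the time derivative vanishes. The logarithmic term is then
   [dg], at least [eta], against the bound assumed in [small]. *)
have dft : ft = H x0 + dg.
  pose k h := H x0 * (t0 + h) + (eta * (t0 + h) + K * (t0 + h) ^+ N.+1) - phi (t0 + h) x0.
  have dk : is_derive (0 : R) 1 k (H x0 + dg - ft).
    apply: is_deriveB; last exact: (is_derive_forward (u := fun s => phi s x0) (phi_derive x0 t0p)).
    apply: is_deriveD.
      by apply: (@is_derive_quadratic _ _ _ _ _ _ 0) => h; rewrite [h *: _]mulr1; ring.
    exact: (is_derive_forward (is_derive_penalty eta K t0 N)).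
  have d0 : 0 < Num.min t0 (T - t0) by rewrite lt_min t0p subr_gt0.
  suff : H x0 + dg - ft = 0 by lra.
  apply: (derive_eq0_at_min d0 dk) => h; rewrite lt_min => /andP[].
  rewrite ltr_norml => /andP[h1 h2] /ltr_normlP[h3 h4].
  have th : 0 <= t0 + h <= T by apply/andP; split; lra.
  have := mx (t0 + h) x0 th; rewrite /F !phi'E//; last by case/andP: th.
  by rewrite /k !addr0; lra.
have form w : `|w| <= 2 -> 0 <= 'D_w ('D_w (phi t0)) x0 <=
    n%:R * (2 * (n%:R * (2 * C))) + T * (n%:R * (2 * (n%:R * (2 * D)))).
  move=> w2; have sp := sphi t0p; apply/andP; split.
    have [p pP] := subgradient_exists x0 (phiCL t0n).1.
    apply: (@second_derive_ge0 _ (fun h => phi t0 (h *: w + x0) - h * dot p w)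
      (fun h => 'D_w (phi t0) (h *: w + x0) - dot p w)).
    - move=> s; apply: is_deriveB.
        apply: ((is_derive_shift_line (phi t0) x0 w _ s).1 _).
        by apply/derivableP/diff_derivable/smooth_differentiable.
      by apply: (@is_derive_quadratic _ _ _ _ _ _ 0) => h; rewrite [h *: _]mulr1; ring.
    - rewrite -[X in is_derive _ _ _ X]subr0; apply: is_deriveB.
        apply: ((is_derive_lineP ('D_w (phi t0)) x0 w _).1 _).
        by apply/derivableP/diff_derivable/smooth_differentiable/smooth_derive.
    - move=> h; rewrite scale0r add0r mul0r subr0; have := pP (h *: w + x0).
      by rewrite addrK !dotE; lra.
  suff : 0 <= 'D_w ('D_w phi0) x0 + t0 * 'D_w ('D_w H) x0 - 'D_w ('D_w (phi t0)) x0.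
    apply: (le_of_bounds (form_le_entries sphi0 (HC x0) w2)
      (form_le_entries sH (HD x0) w2)).
    by rewrite !ltW.
  apply: (@second_derive_ge0 _
      (fun h => phi0 (h *: w + x0) + t0 * H (h *: w + x0) - phi t0 (h *: w + x0))
      (fun h => 'D_w phi0 (h *: w + x0) + t0 * 'D_w H (h *: w + x0)
        - 'D_w (phi t0) (h *: w + x0))).
  - move=> s; apply: is_deriveB; first apply: is_deriveD.
    + apply: ((is_derive_shift_line phi0 x0 w _ s).1 _).
      by apply/derivableP/diff_derivable/smooth_differentiable.
    + apply: is_deriveZ; apply: ((is_derive_shift_line H x0 w _ s).1 _).
      by apply/derivableP/diff_derivable/smooth_differentiable.
    + apply: ((is_derive_shift_line (phi t0) x0 w _ s).1 _).
      by apply/derivableP/diff_derivable/smooth_differentiable.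
  - apply: is_deriveB; first apply: is_deriveD.
    + apply: ((is_derive_lineP ('D_w phi0) x0 w _).1 _).
      by apply/derivableP/diff_derivable/smooth_differentiable/smooth_derive.
    + apply: is_deriveZ; apply: ((is_derive_lineP ('D_w H) x0 w _).1 _).
      by apply/derivableP/diff_derivable/smooth_differentiable/smooth_derive.
    + apply: ((is_derive_lineP ('D_w (phi t0)) x0 w _).1 _).
      by apply/derivableP/diff_derivable/smooth_differentiable/smooth_derive.
  - move=> h; rewrite scale0r add0r.
    have t0T2 : 0 <= t0 <= T by rewrite !ltW.
    by have := mx t0 (h *: w + x0) t0T2; rewrite /F phi'E//; lra.
have detle := norm_det_le (hessian_entry_le (sphi t0p) form).
have dp := det_gt0 x0 t0p; rewrite (gtr0_norm dp) in detle.
have : ln (\det (hessian (phi t0) x0)) <= ln (1 + n`!%:R * (n%:R * (2 * (n%:R * (2 * C))) +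
    T * (n%:R * (2 * (n%:R * (2 * D))))) ^+ n).
  rewrite ler_ln ?posrE//; last by apply: lt_le_trans dp _; lra.
  by apply: le_trans detle _; lra.
have b0 : 0 < beta^-1 by rewrite invr_gt0.
rewrite -(ler_pM2l b0) /ft in dft *; lra.
Qed.

(* At a maximum of
   [<x, z> + delta |x - z|^2 / 2 - phi t x - psi t z] the Hessian of [phi] is at
   least [delta], so that its determinant is bounded below, and in [z] the Hopf
   solution is touched from below. *)
Lemma flow_lower (M1 delta t1 eta : R) :
  (forall t, 0 <= t -> near_halfsq M1 (psi t)) ->
  0 < delta <= 2^-1 -> 0 < t1 -> 0 < eta ->
  (forall x y, `|x - y| <= delta * (1 + 8 * M1) -> `|H x - H y| <= eta / 2) ->
  beta^-1 * - ln (delta ^+ n / n`!%:R) < eta / 2 ->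
  forall x z, dot x z - psi t1 z <= phi t1 x + 2 * M * delta + eta * t1.
Proof.
move=> psiM /andP[del0 del2] t10 eta0 modH small x1 z1.
have M10 : 0 <= M1 by have := psiM 0 (lexx 0) 0; rewrite halfsq0; lra.
have [D D0 DP] := lattice_covering HL.
pose psi' t := psi (Num.max 0 t).
have psi'E t : 0 <= t -> psi' t = psi t by move=> t0; rewrite /psi' max_r.
have cpsi' : continuous (fun p : R * 'rV[R]_n => psi' p.1 p.2).
  apply: (@continuous_clamp _ _ psi); apply: continuous_subspaceT.
  exact: (hopf_continuous npsi0 H0 Hb).
set T := 2 * t1.
have [B BP] := CL_time_near HL phiCL phicont T.
pose F t (e : 'rV[R]_n * 'rV[R]_n) :=
  dot e.1 e.2 + delta * halfsq (e.1 - e.2) - phi' t e.1 - psi' t e.2.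
suff : F t1 (x1, z1) <= 2 * M * delta + eta * t1.
  have := mulr_ge0 (ltW del0) (halfsq_ge0 (x1 - z1)).
  by rewrite /F /= (phi'E (ltW t10)) (psi'E _ (ltW t10)); lra.
have T0 : 0 <= T by rewrite /T; lra.
have B0 : 0 <= B by have := BP 0 _ 0; rewrite lexx T0 halfsq0 => /(_ isT); lra.
pose S := 1 + 8 * (B + M1); have S0 : 0 <= S by rewrite /S; lra.
pose K := [set y : 'rV[R]_n | `|y| <= D] `*` [set y : 'rV[R]_n | `|y| <= D + S].
have DS : 0 <= D + S by lra.
apply: (@time_max _ _ F K (2 * M * delta) eta t1) => //.
- by apply: compact_setX; exact: compact_norm_le.
- by exists (0, 0); split; rewrite /= normr0// ltW.
- have cx : continuous (fun p : R * ('rV[R]_n * 'rV[R]_n) => p.2.1).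
    by apply: (continuous_compf (f := fst)); [exact: continuous_fst|exact: continuous_snd].
  have cz : continuous (fun p : R * ('rV[R]_n * 'rV[R]_n) => p.2.2).
    by apply: (continuous_compf (f := snd)); exact: continuous_snd.
  have ct : continuous (fun p : R * ('rV[R]_n * 'rV[R]_n) => p.1) by exact: continuous_fst.
  apply: continuous_subf; first apply: continuous_subf; first apply: continuous_addf.
  + exact: (continuous_dot cx cz).
  + apply: continuous_mulf; first exact: cst_continuous.
    by apply: continuous_halfsq => p; apply: cvgB; [exact: cx|exact: cz].
  + exact: (continuous_compf cphi' (continuous_pair ct cx)).
  + exact: (continuous_compf cpsi' (continuous_pair ct cz)).
- move=> t [x z] tT; have t0 : 0 <= t by case/andP: tT.
  have [far|close] := leP (4 * (B + M1)) (halfsq (x - z)).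
    exists (0, 0); first by split; rewrite /= normr0// ltW.
    have := BP t tT x; have := BP t tT 0; have := psiM t t0 z; have := psiM t t0 0.
    have fd : delta * halfsq (x - z) <= 2^-1 * halfsq (x - z).
      by rewrite ler_wpM2r// halfsq_ge0.
    move: far fd; rewrite /F /= phi'E// psi'E// subrr halfsq0 dot0l halfsqB.
    move=> h1 h2 /andP[h3 h4] /andP[h5 h6] /andP[h7 h8] /andP[h9 h10].
    lra.
  have [l Ll xl] := DP x.
  exists (x + l, z + l); last first.
    have e : x + l - (z + l) = x - z by rewrite opprD addrACA subrr addr0.
    rewrite /F /= e phi'E// psi'E// (CL_shift _ (phiCL t0) Ll).
    have := CL_shift z (hopf_CL HL CLpsi0 npsi0 pH H0 Hb t) Ll; rewrite -/psi => ->.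
    rewrite !dotE (dotC l z).
    have -> : halfsq l = dot l l / 2 by [].
    lra.
  split => //=.
  have -> : z + l = (x + l) + (z - x) by apply/rowP => i; rewrite !mxE; ring.
  rewrite (le_trans (ler_normD _ _))// lerD// distrC.
  by apply: le_trans (norm_le_halfsq _) _; rewrite /S; lra.
- move=> [x z]; rewrite /F /= phi'E// psi'E// phi_init /psi (hopf0 H CLpsi0.1 npsi0).
  (* [dot x z - phi0 x - psi0 z] is nonpositive, and adding the full [halfsq (x - z)] raises it to
     at most [2 * M]. Mixing the two bounds with weights [1 - delta] and [delta] gives the initial
     error. *)
  have a0 := legendre_ge z x npsi0; rewrite -/phi0 (dotC z) in a0.
  have := npsi0 z; have := nphi0 x => /andP[h1 h2] /andP[h3 h4].
  have h5 : dot x z - phi0 x - psi0 z <= 0 by lra.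
  have h6 : dot x z - phi0 x - psi0 z + halfsq (x - z) <= 2 * M.
    by rewrite halfsqB; lra.
  have d1 : 0 <= 1 - delta by lra.
  have := mulr_ge0_le0 d1 h5.
  have := ler_wpM2l (ltW del0) h6.
  by lra.
move=> C N t0 [x0 z0] C0 t0T _ mx; have [t0p t0T'] := andP t0T.
have t0n : 0 <= t0 by exact: ltW.
have t0T2 : 0 <= t0 <= T by rewrite !ltW.
have sp := sphi t0p.
pose dg := eta + C * (N.+1%:R * t0 ^+ N).
have dg_ge : eta <= dg by rewrite lerDl mulr_ge0// mulr_ge0// exprn_ge0.
(* In the comparison with the diagonal point [(x0, x0)] the values of [phi] cancel. The bound
   therefore involves [M1] but not [B], which depends on the flow and so on [beta]. *)
have dist : `|x0 - z0| <= 1 + 8 * M1.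
  have := mx t0 (x0, x0) t0T2; have := psiM t0 t0n x0; have := psiM t0 t0n z0.
  rewrite /F /= phi'E// psi'E// subrr halfsq0.
  have fd : delta * halfsq (x0 - z0) <= 2^-1 * halfsq (x0 - z0).
    by rewrite ler_wpM2r// halfsq_ge0.
  move=> /andP[h1 h2] /andP[h3 h4] h5; apply: le_trans (norm_le_halfsq _) _.
  move: fd h5; rewrite !halfsqB; have -> : dot x0 x0 = 2 * halfsq x0.
    by rewrite /halfsq; field.
  by lra.
have dp := det_gt0 x0 t0p.
have detlow : delta ^+ n / n`!%:R <= \det (hessian (phi t0) x0).
  apply: det_ge_coercive => // w; rewrite hessian_form// -subr_ge0.
  pose k2 := delta * halfsq w.
  pose k1 := dot w z0 + delta * dot (x0 - z0) w.
  apply: (@second_derive_ge0 _ (fun h => phi t0 (h *: w + x0) - (k1 * h + k2 * h ^+ 2))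
    (fun h => 'D_w (phi t0) (h *: w + x0) - (k1 + 2 * k2 * h))).
  - move=> s; apply: is_deriveB.
      apply: ((is_derive_shift_line (phi t0) x0 w _ s).1 _).
      by apply/derivableP/diff_derivable/smooth_differentiable.
    apply: (@is_derive_quadratic _ _ _ _ _ _ k2) => h.
    by rewrite [h *: _]mulr1; ring.
  - apply: is_deriveB.
      apply: ((is_derive_lineP ('D_w (phi t0)) x0 w _).1 _).
      by apply/derivableP/diff_derivable/smooth_differentiable/smooth_derive.
    apply: (@is_derive_quadratic _ _ _ _ _ _ 0) => h.
    by rewrite [h *: _]mulr1 /k2 /halfsq; field.
  - move=> h; have := mx t0 (h *: w + x0, z0) t0T2.
    rewrite /F /= phi'E// scale0r add0r -addrA !halfsqD halfsqZ !dotE /k1 /k2 !dotE (dotC z0 w).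
    by rewrite (dotC w x0); lra.
pose ft := beta^-1 * ln (\det (hessian (phi t0) x0)) + H x0.
(* With [x0] fixed, [F] bounds [psi] from below near [(t0, z0)] by a function containing the flow;
   its slope in [z] is the argument of [H], within [delta * (1 + 8 * M1)] of [x0]. *)
have sup : 0 <= - ft - dg + H (x0 + delta *: (z0 - x0)).
  apply: (@hopf_super_line _ _ psi0 H M hb CLpsi0.1 npsi0 H0 Hb t0 z0) => // w.
  pose k1 := dot x0 w - delta * dot (x0 - z0) w.
  exists (fun h => k1 * h + delta * halfsq w * h ^+ 2 - phi (t0 - h * t0) x0 -
    (eta * (t0 - h * t0) + C * (t0 - h * t0) ^+ N.+1)), 1.
  split; [|exact: ltr01|].
    have -> : dot (x0 + delta *: (z0 - x0)) w - (- ft - dg) * t0 =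
        k1 - (- (ft * t0)) - (- (dg * t0)).
      by rewrite /k1 !dotE; ring.
    apply: is_deriveB; first apply: is_deriveB.
    - apply: (@is_derive_quadratic _ _ _ _ _ _ (delta * halfsq w)) => h.
      by rewrite [h *: _]mulr1; ring.
    - exact: (is_derive_backward (u := fun s => phi s x0) (phi_derive x0 t0p)).
    - exact: (is_derive_backward (is_derive_penalty eta C t0 N)).
  move=> h /andP[h0 h1]; have sh0 : 0 <= t0 - h * t0.
    by rewrite -[X in X - _]mul1r -mulrBl mulr_ge0// subr_ge0 ltW.
  have shT : 0 <= t0 - h * t0 <= T.
    rewrite -/T in t0T'; have ht := mulr_ge0 (ltW h0) t0n.
    by apply/andP; split => //; lra.
  have := mx (t0 - h * t0) (x0, z0 + h *: w) shT.
  rewrite /F /= !phi'E// !psi'E// -/psi mul0r subr0 expr0n/= !mulr0 addr0.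
  have -> : x0 - (z0 + h *: w) = (x0 - z0) - h *: w by rewrite opprD addrA.
  rewrite (halfsqB (x0 - z0)) halfsqZ !dotE /k1 !dotE.
  by lra.
have lnle : ln (delta ^+ n / n`!%:R) <= ln (\det (hessian (phi t0) x0)).
  by rewrite ler_ln// posrE// divr_gt0// ?exprn_gt0// ltr0n fact_gt0.
have := modH (x0 + delta *: (z0 - x0)) x0 _.
have dx : `|x0 + delta *: (z0 - x0) - x0| <= delta * (1 + 8 * M1).
  rewrite addrAC subrr add0r normrZ (gtr0_norm del0) distrC.
  by rewrite ler_wpM2l// ltW.
move=> /(_ dx); rewrite ler_norml => /andP[_ h1].
have b0 : 0 < beta^-1 by rewrite invr_gt0.
have := ler_wpM2l (ltW b0) lnle.
by move: small sup; rewrite /ft; lra.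
Qed.

End OneFlow.
Lemma hessian_bounds : exists C D, [/\ (forall x i j, `|hessian phi0 x i j| <= C)
  & (forall x i j, `|hessian H x i j| <= D)].
Proof.
have [C _ CP] : exists2 C, 0 <= C & forall x i j, `|hessian phi0 x i j| <= C.
  apply: (hessian_bounded (a := 1) HL sphi0) => l Ll; exists (halfsq l) => y.
  by rewrite mul1r; exact: (CL_shift y (phi0_CL HL CLpsi0 npsi0) Ll).
have [D _ DP] : exists2 C, 0 <= C & forall x i j, `|hessian H x i j| <= C.
  apply: (hessian_bounded (a := 0) HL sH) => l Ll; exists 0 => y.
  by rewrite pH// mul0r !addr0.
by exists C, D.
Qed.

Lemma small_inv (c eta beta : R) : 0 < eta -> (`|c| + 1) / eta <= beta ->
  0 < beta /\ beta^-1 * c < eta.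
Proof.
move=> eta0; have c1 : 0 < `|c| + 1 by rewrite ltr_wpDl.
move=> h; have b0 : 0 < beta by apply: lt_le_trans h; rewrite divr_gt0.
split => //; rewrite mulrC ltr_pdivrMr//; move: h; rewrite ler_pdivrMr// mulrC.
by have := ler_norm c; lra.
Qed.

(** The threshold [b0] is built from constants that do not involve the flow. The upper bound is by
    [phi0 + t * H], which need not be convex; convexity of [phi t] improves it to the convex
    envelope. *)
Lemma flow_limit (t e : R) : 0 < t -> 0 < e ->
  exists b0, forall beta phi, b0 <= beta ->
    (0 < beta -> monge_ampere_flow H L beta phi0 phi) ->
    forall x, `|legendre (psi t) x - phi t x| <= e.
Proof.
move=> t0 e0; have zp := zeros_periodic pH AH.
have [M1 M1P] := hopf_near_unif HL CLpsi0 npsi0 H0 Hb A0 zp (fun x => (AH x).1).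
have M10 : 0 <= M1 by have := M1P 0 (lexx 0) 0; rewrite halfsq0; lra.
have M0 : 0 <= M by have := npsi0 0; rewrite halfsq0; lra.
have [C [D [HC HD]]] := hessian_bounds.
have et : 0 < e / t by rewrite divr_gt0.
have et2 : 0 < e / 2 / t by rewrite !divr_gt0.
have et4 : 0 < e / 2 / t / 2 by rewrite !divr_gt0.
have [dh dh0 dhP] := periodic_uniform1 HL cH pH et4.
have m1 : 0 < 1 + 8 * M1 by lra.
have m2 : 0 < 4 * M + 1 by lra.
have [delta [de0 de2 deh deM]] : exists delta, [/\ 0 < delta, delta <= 2^-1,
    delta * (1 + 8 * M1) <= dh & delta * (4 * M + 1) <= e].
  exists (Num.min 2^-1 (Num.min (dh / (1 + 8 * M1)) (e / (4 * M + 1)))).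
  rewrite -!ler_pdivlMr// !lt_min !ge_min !lexx !orbT invr_gt0 ltr0n/=.
  by rewrite !divr_gt0.
pose c1 := ln (1 + n`!%:R * (n%:R * (2 * (n%:R * (2 * C))) +
    2 * t * (n%:R * (2 * (n%:R * (2 * D))))) ^+ n).
pose c2 := - ln (delta ^+ n / n`!%:R).
exists (Num.max ((`|c1| + 1) / (e / t)) ((`|c2| + 1) / (e / 2 / t / 2))) => beta phi.
rewrite ge_max => /andP[/(small_inv et)[b0 s1] /(small_inv et4)[_ s2]] /(_ b0) flow x.
have up z : phi t z - e <= phi0 z + t * H z.
  by have := flow_upper b0 flow HC HD t0 et s1 z; rewrite divfK ?gt_eqF//; lra.
have dd : 0 < delta <= 2^-1 by rewrite de0.
have modH z w : `|z - w| <= delta * (1 + 8 * M1) -> `|H z - H w| <= e / 2 / t / 2.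
  by move=> zw; apply: dhP; exact: le_trans zw deh.
have low z w : dot z w - psi t w <= phi t z + e.
  have := flow_lower b0 flow M1P dd t0 et2 modH s2 z w; rewrite divfK ?gt_eqF//.
  by move: deM; lra.
have npsit := hopf_near npsi0 H0 Hb t.
rewrite ler_norml; apply/andP; split; last first.
  rewrite lerBlDl addrC; apply: (legendre_le npsit) => z; rewrite dotC.
  by have := low x z; rewrite -/psi; lra.
rewrite lerBrDl.
have cphi : convex_fun (fun z => phi t z - e).
  have [/(_ t (ltW t0))[/convex_funP c _] _ _ _ _] := flow.
  apply/convex_funP => y z s s01.
  have -> : s * (phi t y - e) + (1 - s) * (phi t z - e) =
    s * phi t y + (1 - s) * phi t z - e by ring.
  by rewrite lerD2r; exact: c.
have := @convex_le_biconjugate _ _ setT (M + `|t| * hb) (M + `|t| * hb)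
  (fun x => phi0 x + t * H x) _ _ _ npsit cphi _ x.
apply.
- by exists 0.
- by move=> z; case/andP: (hopf_arg_near npsi0 H0 Hb t z).
- by move=> z _; exact: up.
Qed.

End Flow.

Theorem theorem4p7 (R : realType) (n : nat) (L : set 'rV[R]_n)
    (H : 'rV[R]_n -> R) :
  unimodular_lattice L ->
  smooth_on [set: 'rV[R]_n] H ->
  periodic L H ->
  (exists2 x, minset H x & H x = 0) ->
  discrete_set (minset H) ->
  forall psi0 : 'rV[R]_n -> R, CL L psi0 ->
  let phi0 := legendre psi0 in
  let psi_infty :=
    fun y => sup [set dot x y - phi0 x | x in minset H] in
  exists psi : R -> 'rV[R]_n -> R,
    [/\ viscosity_solution H L psi0 psi,
        forall psi', viscosity_solution H L psi0 psi' ->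
          forall t, 0 <= t -> psi' t = psi t,
        convex_fun psi_infty /\ piecewise_affine psi_infty,
        {uniform, psi @ +oo --> psi_infty} &
        smooth_on [set: 'rV[R]_n] phi0 -> strictly_convex phi0 ->
        forall phib : R -> R -> 'rV[R]_n -> R,
          (forall beta, 0 < beta ->
            monge_ampere_flow H L beta phi0 (phib beta)) ->
        exists phi : R -> 'rV[R]_n -> R,
          (forall t, 0 <= t ->
            {uniform, (fun beta => phib beta t) @ +oo --> phi t} /\
            phi t = legendre (psi t)) /\
          exists phi_infty : 'rV[R]_n -> R,
            [/\ lower_convex_hull (minset H) phi0 phi_infty,
                piecewise_affine phi_infty &
                {uniform, phi @ +oo --> phi_infty}]].
Proof.
move=> HL sH pH [xmin xminP Hxmin] dF psi0 CLpsi0 phi0 psi_infty.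
have cH := smooth_continuous sH.
have H0 x : 0 <= H x by rewrite -Hxmin; exact: xminP.
have [hb hbP] := periodic_bounded1 HL cH pH.
have Hb x : H x <= hb := le_trans (ler_norm _) (hbP x).
have AH x : minset H x <-> H x = 0.
  split=> [xm|Hx y]; last by rewrite Hx.
  by apply/eqP; rewrite eq_le H0 -Hxmin xm.
have A0 : minset H !=set0 by exists xmin.
have zp := zeros_periodic pH AH.
have clA := zeros_closed cH AH.
have [M npsi0] := CL_near HL CLpsi0.
have nphi0 : near_halfsq M phi0 := legendre_near npsi0.
have cphi0 : continuous phi0 := legendre_continuous npsi0.
have lo x : halfsq x - M <= phi0 x by case/andP: (nphi0 x).
have [M1 npsi] := legendre_on_near HL npsi0 A0 zp.
pose psi := hopf psi0 H.
have npsit t := hopf_near npsi0 H0 Hb t.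
have long e : 0 < e -> \forall t \near +oo, forall y, `|psi_infty y - psi t y| <= e.
  move=> e0; have [T TP] := hopf_long_time HL CLpsi0 npsi0 cH pH H0 Hb A0 AH e0.
  have : \forall t \near +oo, T <= t by apply: nbhs_pinfty_ge; rewrite num_real.
  by apply: filterS => t /TP.
exists psi; split.
- split.
  + by move=> t _; exact: (hopf_CL HL CLpsi0 npsi0 pH H0 Hb t).
  + apply: continuous_subspaceT; exact: (hopf_continuous npsi0 H0 Hb).
  + exact: (hopf0 H CLpsi0.1 npsi0).
  + exact: (hopf_viscosity_subsolution npsi0 cH H0 Hb).
  + exact: (hopf_viscosity_supersolution CLpsi0.1 npsi0 H0 Hb).
- move=> v [vCL vcont v0 vsub vsup] t t0; apply/funext => y; apply/eqP.
  rewrite eq_le; apply/andP; split.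
    exact: (subsolution_le_hopf HL CLpsi0 npsi0 cH pH H0 Hb vCL vcont v0 A0 zp
      (fun x => (AH x).1) vsub).
  exact: (supersolution_ge_hopf HL CLpsi0 npsi0 H0 Hb vCL vcont v0 vsup).
- split; first exact: (legendre_on_convex A0 lo).
  apply: locally_max_affine_piecewise.
  exact: (discrete_legendre_max_affine A0 clA dF cphi0 lo npsi).
- exact: cvg_uniformP long.
move=> sphi0 _ phib flow.
exists (fun t => legendre (psi t)); split.
  move=> t t0; split => //; apply: cvg_uniformP => e e0.
  (* [flow_limit] concerns positive times; at time 0 every flow equals [phi0], the transform of
     [psi 0]. *)
  have [t1|t1] := eqVneq t 0.
    have : \forall beta \near +oo, (1 : R) <= beta by apply: nbhs_pinfty_ge; rewrite num_real.
    apply: filterS => beta b1 y; have b0 : 0 < beta by apply: lt_le_trans b1.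
    have [_ _ init _ _] := flow beta b0.
    by rewrite t1 init /psi (hopf0 H CLpsi0.1 npsi0) subrr normr0 ltW.
  have tp : 0 < t by rewrite lt_neqAle eq_sym t1.
  have [b0 bP] := flow_limit HL CLpsi0 npsi0 cH pH H0 Hb A0 AH sphi0 sH tp e0.
  have : \forall beta \near +oo, b0 <= beta by apply: nbhs_pinfty_ge; rewrite num_real.
  by apply: filterS => beta bb; apply: (bP beta (phib beta) bb) => h; exact: flow.
exists (legendre psi_infty); split.
- exact: (biconjugate_hull A0 lo npsi).
- apply: locally_max_affine_piecewise.
  exact: (biconjugate_max_affine A0 clA dF cphi0 lo npsi).
(* The Legendre transform does not increase uniform distances, so the convergence of [psi] carries
   over to the duals. *)
apply: cvg_uniformP => e e0; apply: filterS (long e e0) => t te x.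
rewrite ler_norml; apply/andP; split.
- rewrite lerBrDl lerBlDr; apply: (legendre_lipschitz x npsi (npsit t)) => y.
  by have := te y; rewrite ler_norml => /andP[_]; rewrite lerBlDl.
- rewrite lerBlDl addrC [leRHS]addrC; apply: (legendre_lipschitz x (npsit t) npsi) => y.
  by have := te y; rewrite ler_norml => /andP[+ _]; rewrite lerBrDl lerBlDr.
Qed.
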